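(* Let $\Omega\subsetneq\mathbb{R}^n$, $n\ge2$, be a domain that is Gromov hyperbolic with respect to the quasihyperbolic metric. Then the following are equivalent: (i) $\Omega$ is a QH-visibility domain. (ii) The identity map $id_\Omega$ extends to a continuous surjective map $\widehat{id_\Omega}:\overline{\Omega}^G\to\overline{\Omega}^\infty$, where $\overline{\Omega}^\infty$ denotes the one-point compactification of $\overline{\Omega}^{Euc}$. In particular, every unbounded uniform domain is a QH-visibility domain.
   Context: For a domain $\Omega\subsetneq\mathbb{R}^n$ (not necessarily bounded), $\partial_{Euc}\Omega$ and $\overline{\Omega}^{Euc}$ are its Euclidean boundary and closure in $\mathbb{R}^n$, and $\delta_\Omega(x)=d_{Euc}(x,\partial_{Euc}\Omega)$. The quasihyperbolic metric is $k_\Omega(x,y)=\inf_\gamma\int_\gamma\frac{|dx|}{\delta_\Omega(x)}$, the infimum over rectifiable curves in $\Omega$ joining $x$ and $y$; $(\Omega,k_\Omega)$ is a complete, proper, geodesic metric space, and a quasihyperbolic geodesic is a geodesic of $(\Omega,k_\Omega)$. $\overline{\Omega}^G$ is the Gromov compactification of the Gromov hyperbolic space $(\Omega,k_\Omega)$. The space $\overline{\Omega}^\infty$ is the closure of $\Omega$ in $\mathbb{R}^n\cup\{\infty\}$ (so it equals $\overline{\Omega}^{Euc}$ if $\Omega$ is bounded, and $\overline{\Omega}^{Euc}\cup\{\infty\}$ otherwise). $\Omega$ (not necessarily bounded) is a QH-visibility domain if for every pair of distinct points $p,q\in\partial_{Euc}\Omega$ there exist neighborhoods $U_p$ of $p$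 and $U_q$ of $q$ in $\mathbb{R}^n$ with $\overline{U_p}\cap\overline{U_q}=\emptyset$ and a compact set $K\subset\Omega$ such that every quasihyperbolic geodesic $\gamma:[0,T]\to\Omega$ with $\gamma(0)\in U_p$ and $\gamma(T)\in U_q$ satisfies $\gamma([0,T])\cap K\neq\emptyset$. A domain $\Omega\subsetneq\mathbb{R}^n$ is uniform if there is $C\ge1$ such that every pair $x,y\in\Omega$ can be joined by a rectifiable arc $\gamma$ in $\Omega$ with Euclidean length $l(\gamma)\le C|x-y|$ and $\min\{l(\gamma[x,z]),l(\gamma[z,y])\}\le C\,\delta_\Omega(z)$ for all $z\in\gamma$, where $\gamma[x,z]$ is the part of $\gamma$ between $x$ and $z$. *)

(* Defs.v *)
From HB Require Import structures.
From mathcomp Require Import all_boot all_order all_algebra.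
From mathcomp Require Import all_classical all_reals all_analysis.

Set Implicit Arguments.
Unset Strict Implicit.
Unset Printing Implicit Defensive.

Import Order.TTheory GRing.Theory Num.Theory.
Import numFieldNormedType.Exports.

Local Open Scope classical_set_scope.
Local Open Scope ring_scope.

(* R^n is 'rV[R]_n.  The norm `|x| that the library puts on row vectors is the
   sup norm; it gives the right topology and bounded sets, but distances and
   lengths must be measured with eucl_dist. *)
Section Euclidean.
Variables (R : realType) (n : nat).
Implicit Types (Omega : set 'rV[R]_n) (gamma : R -> 'rV[R]_n).

Definition eucl_dist (x y : 'rV[R]_n) : R :=
  Num.sqrt (\sum_(i < n) (x 0 i - y 0 i) ^+ 2).

Definition domain Omega := [/\ open Omega, connected Omega & Omega !=set0].

Definition eboundary Omega : set 'rV[R]_n := closure Omega `\` Omega°.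

Definition delta Omega (x : 'rV[R]_n) : R :=
  inf [set eucl_dist x y | y in eboundary Omega].

Definition curve_variation (a b : R) gamma (s : seq R) : R :=
  let F := gamma \o nth b (a :: s) in
  \sum_(0 <= i < size s) eucl_dist (F i.+1) (F i).

Definition curve_length gamma (a b : R) : \bar R :=
  ereal_sup [set (curve_variation a b gamma s)%:E | s in itv_partition a b].

Definition rectifiable_curve_in Omega gamma (a b : R) :=
  [/\ a <= b, {within `[a, b], continuous gamma},
      forall t, t \in `[a, b] -> Omega (gamma t) &
      (curve_length gamma a b < +oo)%E].

(* For gamma rectifiable on [a, b] of length L, this is its parametrization by
   arc length, defined on [0, L]. *)
Definition arclength_param gamma (a b : R) (s : R) : 'rV[R]_n :=
  gamma (sup [set t | a <= t <= b /\ (curve_length gamma a t <= s%:E)%E]).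

Definition line_integral (rho : 'rV[R]_n -> R) gamma (a b : R) : \bar R :=
  (\int[lebesgue_measure]_(s in `[0%R, fine (curve_length gamma a b)])
     (rho (arclength_param gamma a b s))%:E)%E.

Definition qh_dist Omega (x y : 'rV[R]_n) : R :=
  fine (ereal_inf [set l | exists gamma a b,
    [/\ rectifiable_curve_in Omega gamma a b, gamma a = x, gamma b = y &
        l = line_integral (fun z => (delta Omega z)^-1) gamma a b]]).

(* The metric space (Omega, k_Omega); its carrier is the subtype of points of
   Omega. *)
Definition qh_metric Omega (x y : Omega) : R := qh_dist Omega (val x) (val y).

Definition qh_geodesic Omega gamma (T : R) :=
  [/\ 0 <= T, forall t, t \in `[0, T] -> Omega (gamma t) &
      forall s t, s \in `[0, T] -> t \in `[0, T] ->
        qh_dist Omega (gamma s) (gamma t) = `|s - t|].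

Definition QH_visibility_domain Omega :=
  domain Omega /\
  forall p q, eboundary Omega p -> eboundary Omega q -> p <> q ->
  exists (Up Uq K : set 'rV[R]_n),
    [/\ nbhs p Up, nbhs q Uq & closure Up `&` closure Uq = set0] /\
    [/\ compact K, K `<=` Omega &
     forall gamma T, qh_geodesic Omega gamma T ->
       Up (gamma 0) -> Uq (gamma T) -> gamma @` `[0, T] `&` K !=set0].

Definition uniform_domain Omega :=
  domain Omega /\
  exists2 C : R, 1 <= C &
  forall x y, Omega x -> Omega y ->
  exists gamma a b,
    [/\ rectifiable_curve_in Omega gamma a b, {in `[a, b] &, injective gamma},
        gamma a = x & gamma b = y] /\
    [/\ (curve_length gamma a b <= (C * eucl_dist x y)%:E)%E &
     forall t, t \in `[a, b] ->
       (Order.min (curve_length gamma a t) (curve_length gamma t b)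
          <= (C * delta Omega (gamma t))%:E)%E].

End Euclidean.

(* Gromov hyperbolicity, Gromov boundary and Gromov compactification of a
   (proper geodesic) metric space (X, d), in terms of the Gromov product.
   Conditions that involve a base point w do not depend on w for such spaces;
   they are required for all w. *)
Section Gromov.
Variables (R : realType) (X : Type) (d : X -> X -> R).

Definition gromov_product (w x y : X) : R := (d x w + d y w - d x y) / 2.

Definition gromov_hyperbolic := exists delta : R, forall w x y z : X,
  Num.min (gromov_product w x y) (gromov_product w y z) - delta
    <= gromov_product w x z.

Definition gromov_equiv (u v : nat -> X) := forall (w : X) (M : R),
  \forall i \near \oo & j \near \oo, M <= gromov_product w (u i) (v j).

Definition gromov_sequence (u : nat -> X) := gromov_equiv u u.

Definition gromov_boundary : Type := {C : set (nat -> X) |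
  exists2 u, gromov_sequence u &
    C = [set v | gromov_sequence v /\ gromov_equiv u v]}.

Variant gromov_compactification : Type :=
  | GInterior of X
  | GBoundary of gromov_boundary.

(* Points z that admit, together with xi, representing sequences whose Gromov
   product is eventually at least r (a point of X is represented by the constant
   sequence); as r varies these are the usual basic neighbourhoods of xi. *)
Definition gromov_nbhd (w : X) (xi : gromov_boundary) (r : R) :
    set gromov_compactification :=
  fun z => match z with
  | GInterior y => exists2 u, sval xi u &
      \forall i \near \oo, r <= gromov_product w (u i) y
  | GBoundary eta => exists u v, [/\ sval xi u, sval eta v &
      \forall i \near \oo & j \near \oo, r <= gromov_product w (u i) (v j)]
  end.

Definition gromov_open : set (set gromov_compactification) := [set O |
  (forall x, O (GInterior x) -> exists2 e : R, 0 < e &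
     forall y, d x y < e -> O (GInterior y)) /\
  (forall xi, O (GBoundary xi) -> forall w, exists r : R,
     gromov_nbhd w xi r `<=` O)].

Lemma gromov_openT : gromov_open setT.
Proof. by split=> [x _|xi _ w]; [exists 1 | exists 0]. Qed.

Lemma gromov_nbhd_le w xi r s : r <= s ->
  gromov_nbhd w xi s `<=` gromov_nbhd w xi r.
Proof.
move=> rs [y [u xiu Hu]|eta [u [v [xiu etav Huv]]]] /=.
  by exists u => //; apply: filterS Hu => i; exact: le_trans.
by exists u, v; split => //; apply: filterS Huv => ij; exact: le_trans.
Qed.

Lemma gromov_openI : setI_closed gromov_open.
Proof.
move=> A B [Ai Ab] [Bi Bb]; split=> [x [Ax Bx]|xi [Axi Bxi] w].
  have [e e0 eA] := Ai _ Ax; have [f f0 fB] := Bi _ Bx.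
  exists (Num.min e f); first by rewrite lt_min e0.
  by move=> y; rewrite lt_min => /andP[/eA ? /fB ?].
have [r rA] := Ab _ Axi w; have [s sB] := Bb _ Bxi w.
exists (Num.max r s) => z zrs; split.
- by apply: rA; apply: gromov_nbhd_le zrs; rewrite le_max lexx.
- by apply: sB; apply: gromov_nbhd_le zrs; rewrite le_max lexx orbT.
Qed.

Lemma gromov_open_bigU (I : Type) (f : I -> set gromov_compactification) :
  (forall i, gromov_open (f i)) -> gromov_open (\bigcup_i f i).
Proof.
move=> fo; split=> [x [i _ fix_]|xi [i _ fixi] w].
  have [e e0 ef] := (fo i).1 _ fix_.
  by exists e => // y /ef ?; exists i.
have [r rf] := (fo i).2 _ fixi w.
by exists r => z /rf ?; exists i.
Qed.

HB.instance Definition _ := gen_eqMixin gromov_compactification.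
HB.instance Definition _ := gen_choiceMixin gromov_compactification.
HB.instance Definition _ := isOpenTopological.Build gromov_compactification
  gromov_openT gromov_openI gromov_open_bigU.

End Gromov.

(* The closure of Omega in R^n together with the point at infinity (None).  It
   contains None exactly when Omega is unbounded. *)
Definition closure_infty (R : realType) (n : nat) (Omega : set 'rV[R]_n) :
    set (one_point_compactification 'rV[R]_n) :=
  closure ((Some : 'rV[R]_n -> one_point_compactification 'rV[R]_n) @` Omega).

(* Main.v *)
Require Import Defs.
From HB Require Import structures.
From mathcomp Require Import all_boot all_order all_algebra.
From mathcomp Require Import all_classical all_reals all_analysis.
From mathcomp Require Import ring lra.

(** Write k for the quasihyperbolic metric and (x|y)_w for its Gromov product.
    The infimum defining k may be taken over 1-Lipschitz curves, so k is a
    metric, locally comparable to |x - y| / delta; its closed balls are compact,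
    and ultrafilter limits of almost shortest curves are geodesics.

    (i) => (ii): let p be a boundary point and r > 0.  If geodesics from points
    x_m -> p to points outside the ball B(p, r) escaped every k-ball, their first
    hitting points on the sphere would accumulate at a boundary point q <> p,
    against visibility for (p, q).  As (x|y)_w is at most the distance from w to a
    geodesic [x, y], it is bounded for x near p and y outside B(p, r).  So every
    Gromov sequence has a unique limit in the one-point compactification, which
    depends continuously on the Gromov boundary point.

    (ii) => (i): in a hyperbolic space (x|y)_w is the distance from w to [x, y] up
    to a constant.  Geodesics from x_m -> p to y_m -> q escaping every k-ball
    would thus give one Gromov boundary point whose image is both p and q.

    Uniform domains: the cigar condition yields
    k(x, y) <= A + |x - y| / (4 min(delta x, delta y)).  Cutting a geodesic on
    which delta <= m where delta last takes the values m, m/2, m/4, ... bounds its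
    Euclidean diameter by a multiple of m, so a geodesic joining neighbourhoods of
    p and q meets a compact set {delta >= eps, |z - p| <= R}. *)

Set Implicit Arguments.
Unset Strict Implicit.
Unset Printing Implicit Defensive.

Import Order.TTheory GRing.Theory Num.Theory.
Import numFieldNormedType.Exports.

Local Open Scope classical_set_scope.
Local Open Scope ring_scope.

(** * Euclidean distance and distance to the boundary *)

(** The definition of k passes through arc length and Lebesgue integrals, which are awkward to cut
    and paste. Hence 1-Lipschitz curves, a class stable under restriction, reversal and
    concatenation, and a principle that compares two functions by their increments on short
    intervals; it takes the place of every change of variables. Neither geodesics nor compact balls
    are available at the start: rough geodesics give compactness of balls, and compactness gives
    geodesics. Visibility speaks of finite boundary points only, so infinity is reached by
    exclusion: a sequence that leaves every k-ball and does not tend to infinity clusters at a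
    boundary point, where visibility applies. The factor 4 in the bound for uniform domains is
    chosen for absorption: if delta <= f on a piece of geodesic whose ends satisfy delta >= f/2, the
    Euclidean distance D of the ends is at most f times the quasihyperbolic length, hence at most f
    A + D/2, so D <= 2 f A. The scales f, f/2, f/4, ... then add up as a geometric series. *)

Section EuclideanDistance.
Context {R : realType} {n : nat}.
Implicit Types x y z : 'rV[R]_n.

Lemma sum_sqr_ge0 (I : finType) (a : I -> R) : 0 <= \sum_i a i ^+ 2.
Proof. by apply: sumr_ge0 => i _; exact: sqr_ge0. Qed.

(** Lagrange's identity: the sum over i, j of the squares of a_i b_j - a_j b_i is twice the
    difference of the two sides. *)
Lemma cauchy_schwarz_sum (I : finType) (a b : I -> R) :
  (\sum_i a i * b i) ^+ 2 <= (\sum_i a i ^+ 2) * (\sum_i b i ^+ 2).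
Proof.
have H : 0 <= \sum_i \sum_j (a i * b j - a j * b i) ^+ 2.
  by apply: sumr_ge0 => i _; apply: sum_sqr_ge0.
suff E : \sum_i \sum_j (a i * b j - a j * b i) ^+ 2 =
   2 * ((\sum_i a i ^+ 2) * (\sum_i b i ^+ 2) - (\sum_i a i * b i) ^+ 2).
  by move: H; rewrite E pmulr_rge0// subr_ge0.
pose A := \sum_i \sum_j a i ^+ 2 * b j ^+ 2.
have EA : (\sum_i a i ^+ 2) * (\sum_i b i ^+ 2) = A.
  by rewrite mulr_suml; apply: eq_bigr => i _; rewrite mulr_sumr.
have EB : (\sum_i a i * b i) ^+ 2 = \sum_i \sum_j (a i * b i) * (a j * b j).
  by rewrite expr2 mulr_suml; apply: eq_bigr => i _; rewrite mulr_sumr.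
have EC : A = \sum_i \sum_j a j ^+ 2 * b i ^+ 2 by rewrite /A exchange_big.
rewrite EA EB [2 * _]mulrBr mulr_natl mulr2n {2}EC -big_split/= mulr_sumr -sumrB.
apply: eq_bigr => i _; rewrite -big_split/= mulr_sumr -sumrB.
by apply: eq_bigr => j _; ring.
Qed.

Lemma eucl_dist_ge0 x y : 0 <= eucl_dist x y.
Proof. exact: sqrtr_ge0. Qed.

Lemma eucl_distxx x : eucl_dist x x = 0.
Proof.
rewrite /eucl_dist big1 ?sqrtr0// => i _.
by rewrite subrr expr0n.
Qed.

Lemma eucl_distC x y : eucl_dist x y = eucl_dist y x.
Proof. by rewrite /eucl_dist; congr Num.sqrt; apply: eq_bigr => i _; rewrite -sqrrN opprB. Qed.

Lemma eucl_dist_triangle y x z :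
  eucl_dist x z <= eucl_dist x y + eucl_dist y z.
Proof.
rewrite -(ler_pXn2r (n := 2))// ?nnegrE ?addr_ge0 ?eucl_dist_ge0//.
rewrite sqrrD /eucl_dist !sqr_sqrtr ?sum_sqr_ge0//.
set a := fun i => x 0 i - y 0 i; set b := fun i => y 0 i - z 0 i.
rewrite [leLHS](_ : _ = \sum_i a i ^+ 2 + (\sum_i a i * b i) *+ 2 + \sum_i b i ^+ 2).
  rewrite lerD2r lerD2l lerMn2r/=.
  rewrite -sqrtrM ?sum_sqr_ge0//.
  apply: (le_trans (ler_norm _)).
  by rewrite -sqrtr_sqr ler_wsqrtr// cauchy_schwarz_sum.
rewrite -sumrMnl -!big_split/=; apply: eq_bigr => i _.
by rewrite /a /b -sqrrD; congr (_ ^+ 2); ring.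
Qed.

Lemma le_norm_eucl_dist x y : `|x - y| <= eucl_dist x y.
Proof.
rewrite [leLHS]/Num.norm/= mx_normrE; apply: bigmax_le; first exact: eucl_dist_ge0.
move=> [i j] _ /=; rewrite !mxE (ord1 i) -sqrtr_sqr ler_wsqrtr//.
by rewrite (bigD1 j)//= lerDl; apply: sumr_ge0 => k _; exact: sqr_ge0.
Qed.

(** The crude constant [n.+1] stands for the square root of n; being nonzero for every n, it can be
    divided by in [nbhs_eucl]. *)
Lemma eucl_dist_le_norm x y : eucl_dist x y <= n.+1%:R * `|x - y|.
Proof.
have H : eucl_dist x y ^+ 2 <= (n.+1%:R * `|x - y|) ^+ 2.
  rewrite /eucl_dist sqr_sqrtr ?sum_sqr_ge0//.
  apply: (@le_trans _ _ (\sum_(i < n) `|x - y| ^+ 2)).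
    apply: ler_sum => i _; rewrite -[leLHS]real_normK ?num_real//.
    rewrite ler_sqr ?nnegrE// [leRHS]/Num.norm/= mx_normrE.
    by rewrite (le_trans _ (le_bigmax _ _ (ord0, i)))//= !mxE.
  rewrite sumr_const card_ord exprMn -[_ *+ n]mulr_natl ler_wpM2r ?sqr_ge0//.
  by rewrite -natrX ler_nat (leq_trans (leqnSn _))// leq_pmull.
by rewrite -(ler_pXn2r (n := 2))// nnegrE ?eucl_dist_ge0// mulr_ge0.
Qed.

Lemma eucl_dist_le0 x y : eucl_dist x y <= 0 -> x = y.
Proof.
move=> h; apply/eqP; rewrite -subr_eq0 -normr_eq0 eq_le normr_ge0 andbT.
exact: le_trans (le_norm_eucl_dist _ _) h.
Qed.

Lemma nbhs_eucl x (A : set 'rV[R]_n) :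
  nbhs x A <-> exists2 e : R, 0 < e & forall y, eucl_dist x y < e -> A y.
Proof.
split.
  move=> /nbhs_normP [e /= e0 eA]; exists e => // y xy; apply: eA => /=.
  by rewrite (le_lt_trans (le_norm_eucl_dist _ _)).
move=> [e e0 eA]; apply/nbhs_ballP; exists (e / n.+1%:R) => /=.
  by rewrite divr_gt0.
move=> y; rewrite mx_norm_ball /ball_ /= ltr_pdivlMr// mulrC => xy; apply: eA.
by rewrite (le_lt_trans (eucl_dist_le_norm _ _)).
Qed.

Lemma eucl_dist_line x y (s t : R) :
  eucl_dist (x + s *: (y - x)) (x + t *: (y - x)) = `|s - t| * eucl_dist x y.
Proof.
rewrite /eucl_dist -[X in X * _]sqrtr_sqr -sqrtrM ?sqr_ge0// mulr_sumr.
congr Num.sqrt; apply: eq_bigr => i _; rewrite !mxE -exprMn -sqrrN; congr (_ ^+ 2).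
by ring.
Qed.

Lemma eucl_dist_line0 x y (t : R) :
  eucl_dist x (x + t *: (y - x)) = `|t| * eucl_dist x y.
Proof. by have := eucl_dist_line x y 0 t; rewrite scale0r addr0 sub0r normrN. Qed.

Lemma eucl_dist_sub_le x y z : `|eucl_dist x z - eucl_dist y z| <= eucl_dist x y.
Proof.
rewrite ler_norml; apply/andP; split.
  rewrite -lerBlDr opprK addrC lerBlDr.
  by rewrite (le_trans (eucl_dist_triangle x y z))// eucl_distC addrC.
by rewrite lerBlDr eucl_dist_triangle.
Qed.

Lemma continuous_eucl_dist z : continuous (fun x => eucl_dist x z).
Proof.
move=> x; apply/(@cvgrPdist_lt _ _ _ _ (nbhs_filter x)) => e e0.
apply/nbhs_eucl; exists e => // y xy /=.
exact: le_lt_trans (eucl_dist_sub_le _ _ _) xy.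
Qed.

Lemma closed_eucl_ball z r : closed [set x | eucl_dist x z <= r].
Proof.
have -> : [set x | eucl_dist x z <= r] = (fun x => eucl_dist x z) @^-1` [set u | u <= r].
  by [].
by apply: closed_comp; [move=> x _; exact: continuous_eucl_dist|exact: closed_le].
Qed.

Lemma compact_eucl_bounded (A : set 'rV[R]_n) z r : closed A ->
  (forall x, A x -> eucl_dist x z <= r) -> compact A.
Proof.
move=> clA Ar; apply: bounded_closed_compact => //.
exists (`|z| + r); split; first exact: num_real.
move=> M rM x Ax; apply: le_trans (ltW rM).
rewrite -{1}[x](subrK z) addrC (le_trans (ler_normD _ _))// lerD2l.
by rewrite (le_trans (le_norm_eucl_dist _ _))// Ar.
Qed.

Lemma compact_eucl_ball z r : compact [set x | eucl_dist x z <= r].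
Proof. by apply: (@compact_eucl_bounded _ z r) => //; exact: closed_eucl_ball. Qed.

End EuclideanDistance.

Section BoundaryDistance.
Context {R : realType} {n : nat} (Omega : set 'rV[R]_n).
Hypothesis Odom : domain Omega.
Hypothesis OT : Omega <> setT.
Local Notation delta := (delta Omega).
Implicit Types x y z : 'rV[R]_n.

Let oO : open Omega. Proof. by case: Odom. Qed.

Lemma not_eboundary x : Omega x -> ~ eboundary Omega x.
Proof. by move=> Ox [_]; apply; rewrite ((interior_id Omega).1 oO). Qed.

Lemma eboundaryP x : closure Omega x -> ~ Omega x -> eboundary Omega x.
Proof. by move=> cx nx; split => // /(@interior_subset _ _ x). Qed.

Lemma continuous_line x y : continuous (fun t : R => x + t *: (y - x)).
Proof.
move=> t; apply: (@cvgD _ _ _ _ (nbhs_filter t) (fun=> x)); first exact: cvg_cst.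
by apply: cvgZr_tmp; exact: cvg_id.
Qed.

(* Otherwise [0, 1] would split into the parts mapped to Omega and off its closure. *)
Lemma segment_exit x y : Omega x -> ~ Omega y ->
  exists2 t : R, 0 <= t <= 1 & eboundary Omega (x + t *: (y - x)).
Proof.
move=> Ox nOy; apply: contrapT => H.
pose line (t : R) := x + t *: (y - x).
have lcont : continuous line := @continuous_line x y.
suff /seteqP[_ /(_ 1)/=] : `[0, 1] `&` (line @^-1` Omega) = `[0, 1]%classic.
  rewrite in_itv/= lexx ler01 => /(_ isT)[_].
  by rewrite /line scale1r addrC subrK.
have /= := @segment_connected R 0 1; apply.
- by exists 0; split; rewrite /= ?in_itv/= ?lexx ?ler01// /line scale0r addr0.
- by exists (line @^-1` Omega) => //; apply: open_comp => // t _; exact: lcont.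
- exists (line @^-1` closure Omega).
    by apply: closed_comp; [move=> t _; exact: lcont|exact: closed_closure].
  apply/seteqP; split => t /= [t01 Ot]; split => //; first exact: subset_closure.
  apply: contrapT => nOt; apply: H; exists t; last exact: eboundaryP.
  by move: t01; rewrite in_itv.
Qed.

Lemma eboundary_neq0 : eboundary Omega !=set0.
Proof.
case: Odom => _ _ [x Ox]; apply: contrapT => H; apply: OT.
apply/seteqP; split => // y _; apply: contrapT => nOy.
by have [t _ ?] := segment_exit Ox nOy; apply: H; eexists; eassumption.
Qed.

Let dset x := [set eucl_dist x y | y in eboundary Omega].

Let has_inf_dset x : has_inf (dset x).
Proof.
split; first by have [y ?] := eboundary_neq0; exists (eucl_dist x y), y.
by exists 0 => _ [y _ <-]; exact: eucl_dist_ge0.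
Qed.

Lemma delta_le x y : eboundary Omega y -> delta x <= eucl_dist x y.
Proof. by move=> ey; apply: ge_inf; [case: (has_inf_dset x)|exists y]. Qed.

Lemma delta_ge x r : (forall y, eboundary Omega y -> r <= eucl_dist x y) -> r <= delta x.
Proof.
move=> H; apply: lb_le_inf; first by case: (has_inf_dset x).
by move=> _ [y ey <-]; exact: H.
Qed.

Lemma delta_lip x y : delta x <= delta y + eucl_dist x y.
Proof.
rewrite -lerBlDr; apply: delta_ge => z ez; rewrite lerBlDr.
by rewrite (le_trans (delta_le x ez))// addrC eucl_dist_triangle.
Qed.

Lemma delta_ball x y : Omega x -> eucl_dist x y < delta x -> Omega y.
Proof.
move=> Ox xy; apply: contrapT => nOy; have [t /andP[t0 t1] et] := segment_exit Ox nOy.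
have := delta_le x et; rewrite eucl_dist_line0 ger0_norm// leNgt => /negP; apply.
by rewrite (le_lt_trans _ xy)// ler_piMl// eucl_dist_ge0.
Qed.

Lemma delta_gt0 x : Omega x -> 0 < delta x.
Proof.
move=> Ox; have /nbhs_eucl[e e0 eO] : nbhs x Omega by apply: open_nbhs_nbhs; split.
apply: lt_le_trans e0 _; apply: delta_ge => y ey; rewrite leNgt; apply/negP => /eO Oy.
exact: not_eboundary ey.
Qed.

Lemma closure_delta_gt0 x : closure Omega x -> 0 < delta x -> Omega x.
Proof.
move=> cx dx; apply: contrapT => nOx.
have /delta_le := eboundaryP cx nOx; move/(_ x).
by rewrite eucl_distxx leNgt dx.
Qed.

Lemma continuous_delta : continuous (delta : 'rV[R]_n -> R).
Proof.
move=> x; apply/(@cvgrPdist_lt _ _ _ _ (nbhs_filter x)) => e e0.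
apply/nbhs_eucl; exists e => // y xy /=; apply: le_lt_trans xy.
have := delta_lip x y; have := delta_lip y x; rewrite (eucl_distC y) => h1 h2.
by rewrite ler_distl; apply/andP; split; lra.
Qed.

(** A limit point outside Omega would be a boundary point, where [delta] vanishes. This makes sets
    on which [delta] is bounded below closed in the whole space and not merely in Omega. *)
Lemma closure_delta_ge (A : set 'rV[R]_n) c z : 0 < c ->
  (forall u, A u -> Omega u /\ c <= delta u) -> closure A z -> Omega z /\ c <= delta z.
Proof.
move=> c0 AO cz; have cdz : c <= delta z.
  have : closed (delta @^-1` [set t | c <= t]).
    by apply: closed_comp => [u _|]; [exact: continuous_delta|exact: closed_ge].
  move/closure_id => E; suff : (delta @^-1` [set t | c <= t]) z by [].
  by rewrite E; apply: closure_subset cz => u /AO[].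
split => //; apply: closure_delta_gt0; last exact: lt_le_trans cdz.
by apply: closure_subset cz => u /AO[].
Qed.

End BoundaryDistance.

(** * Length and arc length *)

Section WithinContinuity.
Context {R : realType} {n : nat}.
Implicit Types (a b : R) (gamma : R -> 'rV[R]_n).

Lemma within_continuous_eucl a b gamma :
  {within `[a, b], continuous gamma} <->
  forall t, a <= t <= b -> forall e, 0 < e -> exists2 d : R, 0 < d &
    forall u, a <= u <= b -> `|u - t| < d -> eucl_dist (gamma t) (gamma u) < e.
Proof.
split=> [/subspace_continuousP H t tab e e0|H].
  have := H t; rewrite /= in_itv/= => /(_ tab) /(_ [set y | eucl_dist (gamma t) y < e]).
  move=> /(_ _)[]; first by apply/nbhs_eucl; exists e.
  move=> d /= d0 dP; exists d => // u uab ut.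
  by apply: (dP u); rewrite /= ?in_itv// distrC.
apply/subspace_continuousP => t /=; rewrite in_itv/= => tab A /nbhs_eucl[e e0 eA].
have [d d0 dP] := H t tab e e0.
exists d => //= u /= ut; rewrite in_itv/= => uab; apply: eA; apply: dP => //.
by rewrite distrC.
Qed.

Lemma within_continuous_real a b (f : R -> R) :
  {within `[a, b], continuous f} <->
  forall t, a <= t <= b -> forall e, 0 < e -> exists2 d : R, 0 < d &
    forall u, a <= u <= b -> `|u - t| < d -> `|f t - f u| < e.
Proof.
split=> [/subspace_continuousP H t tab e e0|H].
  have := H t; rewrite /= in_itv/= => /(_ tab) /(_ [set y | `|f t - y| < e]).
  move=> /(_ _)[]; first by exists e.
  move=> d /= d0 dP; exists d => // u uab ut.
  by apply: (dP u); rewrite /= ?in_itv// distrC.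
apply/subspace_continuousP => t /=; rewrite in_itv/= => tab A [e /= e0 eA].
have [d d0 dP] := H t tab e e0.
exists d => //= u /= ut; rewrite in_itv/= => uab; apply: eA => /=; apply: dP => //.
by rewrite distrC.
Qed.

End WithinContinuity.

Section CurveLength.
Context {R : realType} {n : nat} (gamma : R -> 'rV[R]_n).
Implicit Types (a b c s t : R) (p : seq R).
Local Notation cv := (fun a b => curve_variation a b gamma).
Local Notation len := (curve_length gamma).

Lemma curve_variation_nil a b : cv a b [::] = 0.
Proof. by rewrite /curve_variation big_nil. Qed.

Lemma curve_variation_cons a b x p :
  cv a b (x :: p) = eucl_dist (gamma x) (gamma a) + cv x b p.
Proof. by rewrite /curve_variation/= big_nat_recl. Qed.

Lemma curve_variation_ge0 a b p : 0 <= cv a b p.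
Proof. by apply: sumr_ge0 => i _; exact: eucl_dist_ge0. Qed.

Lemma curve_variation_cat a b c p q : itv_partition a c p ->
  cv a b (p ++ q) = cv a c p + cv c b q.
Proof.
elim: p a => [a /itv_partition_nil ->|x p ih a pP].
  by rewrite curve_variation_nil add0r.
by rewrite cat_cons !curve_variation_cons ih ?addrA//; exact: itv_partition_cons pP.
Qed.

Lemma le_curve_length a b p : itv_partition a b p ->
  ((cv a b p)%:E <= len a b)%E.
Proof. by move=> pP; apply: ereal_sup_ubound; exists p. Qed.

Lemma eucl_dist_le_curve_length a b : a <= b ->
  ((eucl_dist (gamma b) (gamma a))%:E <= len a b)%E.
Proof.
rewrite le_eqVlt => /predU1P[->|ab].
  rewrite eucl_distxx -(curve_variation_nil b b); apply: le_curve_length.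
  by split => /=.
have := le_curve_length (itv_partition1 ab).
by rewrite curve_variation_cons curve_variation_nil addr0.
Qed.

Lemma curve_length_ge0 a b : a <= b -> (0 <= len a b)%E.
Proof.
move=> /eucl_dist_le_curve_length; apply: le_trans.
by rewrite lee_fin eucl_dist_ge0.
Qed.

(** Partitions of the two halves are concatenated. The suprema are taken one at a time by moving the
    other term across the inequality, which requires that term to be finite; hence [abfin] and
    [cbfin]. *)
Lemma curve_length_super a b c : a <= c -> c <= b ->
  (len a c + len c b <= len a b)%E.
Proof.
move=> ac cb.
have step p : itv_partition a c p -> ((cv a c p)%:E + len c b <= len a b)%E.
  move=> pP; rewrite addeC -leeBrDr//; apply: ge_ereal_sup => _ [q qP <-].
  rewrite leeBrDr// -EFinD addrC -curve_variation_cat//.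
  exact/le_curve_length/(itv_partition_cat pP qP).
have [->|] := eqVneq (len a b) +oo%E; first by rewrite leey.
rewrite -ltey => abfin.
have cbfin : len c b \is a fin_num.
  rewrite ge0_fin_numE ?curve_length_ge0//; apply: le_lt_trans abfin.
  move: ac; rewrite le_eqVlt => /predU1P[->//|ac].
  apply: le_trans (step _ (itv_partition1 ac)).
  by rewrite leeDr// lee_fin curve_variation_ge0.
rewrite -leeBrDr//; apply: ge_ereal_sup => _ [p pP <-].
by rewrite leeBrDr// step.
Qed.

Lemma curve_length_cons a b x : a <= x -> x <= b ->
  ((eucl_dist (gamma x) (gamma a))%:E + len x b <= len a b)%E.
Proof.
move=> ax xb; apply: le_trans (curve_length_super ax xb).
by rewrite leeD2r// eucl_dist_le_curve_length.
Qed.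

Lemma curve_lengthD a b c : a <= c -> c <= b ->
  len a b = (len a c + len c b)%E.
Proof.
move=> ac cb; apply/eqP; rewrite eq_le curve_length_super// andbT.
apply: ge_ereal_sup => _ [p pP <-].
(* Follow the partition up to the step from a to x that jumps over c, and insert c there by the
   triangle inequality. *)
elim: p a ac pP => [a ac _|x p ih a ac pP].
  by rewrite curve_variation_nil adde_ge0// curve_length_ge0.
have xp := itv_partition_cons pP; rewrite curve_variation_cons EFinD.
have ax : a < x by case: pP => /= /andP[].
have [xc|cx] := leP x c.
  apply: (@le_trans _ _ ((eucl_dist (gamma x) (gamma a))%:E + (len x c + len c b))%E).
    by rewrite leeD2l// ih.
  by rewrite addeA leeD2r// curve_length_cons// ltW.
apply: (@le_trans _ _ ((eucl_dist (gamma c) (gamma a))%:E +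
    ((eucl_dist (gamma x) (gamma c))%:E + (cv x b p)%:E))%E).
  rewrite -!EFinD lee_fin addrA lerD2r [leRHS]addrC.
  exact: eucl_dist_triangle.
rewrite leeD// ?eucl_dist_le_curve_length//.
have := @le_curve_length c b (x :: p); rewrite curve_variation_cons EFinD; apply.
by split => /=; [rewrite cx; case: xp|case: xp].
Qed.

Lemma curve_lengthxx a : len a a = 0%E.
Proof.
apply/eqP; rewrite eq_le curve_length_ge0// andbT.
apply: ge_ereal_sup => _ [p /itv_partitionxx -> <-].
by rewrite curve_variation_nil.
Qed.

End CurveLength.

(** Speed at most 1 rather than exactly 1: unlike a parametrization by arc length, it can be checked
    without computing any length. *)
Definition lip1 {R : realType} {n : nat} (c : R -> 'rV[R]_n) (L : R) :=
  forall s t, 0 <= s -> s <= t -> t <= L -> eucl_dist (c s) (c t) <= t - s.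

Section ArcLength.
Context {R : realType} {n : nat}.
Implicit Types (gamma c : R -> 'rV[R]_n) (a b s t L : R).

Lemma lip1_continuous c L : lip1 c L -> {within `[0, L], continuous c}.
Proof.
move=> cl; apply/within_continuous_eucl => t /andP[t0 tL] e e0.
exists e => // u /andP[u0 uL] ut; apply: le_lt_trans ut.
have [tu|/ltW ut] := leP t u.
  by rewrite ger0_norm ?subr_ge0// cl.
by rewrite eucl_distC ler0_norm ?subr_le0// opprB cl.
Qed.

Lemma lip1_length c L s t : lip1 c L -> 0 <= s -> s <= t -> t <= L ->
  (curve_length c s t <= (t - s)%:E)%E.
Proof.
move=> cl s0 st tL; apply: ge_ereal_sup => _ [p pP <-]; rewrite lee_fin.
elim: p s s0 st pP => [s s0 st _|x p ih s s0 st pP].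
  by rewrite curve_variation_nil subr_ge0.
have xp := itv_partition_cons pP; rewrite curve_variation_cons.
have sx : s <= x by case: pP => /= /andP[/ltW].
have xt : x <= t by exact: itv_partition_le xp.
have -> : t - s = (x - s) + (t - x) by ring.
rewrite lerD//; first by rewrite eucl_distC cl// (le_trans xt).
by rewrite ih// (le_trans s0).
Qed.

Lemma lip1_rectifiable Omega c L : 0 <= L -> lip1 c L ->
  (forall t, 0 <= t <= L -> Omega (c t)) -> rectifiable_curve_in Omega c 0 L.
Proof.
move=> L0 cl cO; split => //; first exact: lip1_continuous.
by rewrite (le_lt_trans (lip1_length cl _ _ _))// ltry.
Qed.

Section param.
Variables (gamma : R -> 'rV[R]_n) (a b : R).
Hypothesis ab : a <= b.
Hypothesis gcont : {within `[a, b], continuous gamma}.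
Hypothesis gfin : (curve_length gamma a b < +oo)%E.
Local Notation len := (curve_length gamma).
Local Notation V t := (fine (len a t)).

Lemma rectifiable_sub_fin s t : a <= s -> s <= t -> t <= b -> len s t \is a fin_num.
Proof.
move=> sa st tb; rewrite ge0_fin_numE ?curve_length_ge0//.
apply: le_lt_trans gfin; rewrite (@curve_lengthD _ _ _ a b s)//; last exact: le_trans tb.
rewrite (@curve_lengthD _ _ _ s b t)// addeC -addeA leeDl// adde_ge0 ?curve_length_ge0//.
Qed.

Lemma fine_curve_lengthB s t : a <= s -> s <= t -> t <= b ->
  V t - V s = fine (len s t).
Proof.
move=> sa st tb.
rewrite (@curve_lengthD _ _ _ a t s)// fineD ?rectifiable_sub_fin//; last exact: le_trans tb.
by rewrite addrC addKr.
Qed.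

Lemma eucl_dist_le_lengthB s t : a <= s -> s <= t -> t <= b ->
  eucl_dist (gamma s) (gamma t) <= V t - V s.
Proof.
move=> sa st tb; rewrite fine_curve_lengthB// -lee_fin fineK ?rectifiable_sub_fin//.
by rewrite eucl_distC eucl_dist_le_curve_length.
Qed.

Lemma fine_curve_length_homo s t : a <= s -> s <= t -> t <= b -> V s <= V t.
Proof.
by move=> sa st tb; rewrite -subr_ge0 fine_curve_lengthB// fine_ge0// curve_length_ge0.
Qed.

Let S s := [set t | a <= t <= b /\ (len a t <= s%:E)%E].
Let tau s := sup (S s).

Let has_sup_S s : 0 <= s -> has_sup (S s).
Proof.
move=> s0; split; last by exists b => t [/andP[]].
by exists a; split; rewrite ?lexx// curve_lengthxx lee_fin.
Qed.

Let tau_itv s : 0 <= s -> a <= tau s <= b.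
Proof.
move=> s0; apply/andP; split.
  apply: ub_le_sup; first by case: (has_sup_S s0).
  by split; rewrite ?lexx// curve_lengthxx lee_fin.
by apply: ge_sup; [case: (has_sup_S s0)|move=> t [/andP[]]].
Qed.

Let tau_lt s t : 0 <= s -> a <= t -> t < tau s -> V t <= s.
Proof.
move=> s0 ta ts; have [_ tb] := andP (tau_itv s0).
have [u [/andP[au ub] us] tu] := sup_gt (has_sup_S s0).1 ts.
rewrite -lee_fin fineK ?rectifiable_sub_fin// ?(le_trans (ltW ts))//.
apply: le_trans us; rewrite (@curve_lengthD _ _ _ a u t) ?(ltW tu)//.
by rewrite leeDl// curve_length_ge0// ltW.
Qed.

Let tau_gt s t : 0 <= s -> t <= b -> tau s < t -> s < V t.
Proof.
move=> s0 tb st; have /andP[ta _] := tau_itv s0.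
have at_ : a <= t by exact: le_trans (ltW st).
rewrite -lte_fin fineK ?rectifiable_sub_fin// ltNge; apply/negP => H.
move: st; rewrite ltNge => /negP; apply.
by apply: ub_le_sup; [case: (has_sup_S s0)|split => //; rewrite at_].
Qed.

Let tau_homo s t : 0 <= s -> s <= t -> tau s <= tau t.
Proof.
move=> s0 st; rewrite leNgt; apply/negP => ts.
have [u [/andP[au ub] us] tu] := sup_gt (has_sup_S s0).1 ts.
move: tu; rewrite ltNge => /negP; apply; apply: ub_le_sup.
  by case: (has_sup_S (le_trans s0 st)).
by split; [rewrite au|rewrite (le_trans us)// lee_fin].
Qed.

Local Notation c := (arclength_param gamma a b).

Lemma arclength_param_in_image s : 0 <= s -> exists2 t, a <= t <= b & c s = gamma t.
Proof. by move=> s0; exists (tau s) => //; exact: tau_itv. Qed.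

(** [tau] is a generalized inverse of the length function V. It may jump, and continuity of V is not
    at hand, so V (tau s) = s cannot be used. Only V > s to the right of [tau s] and V <= t to the
    left of [tau t] are known; points u and v on those sides satisfy V v - V u <= t - s, and
    continuity of gamma lets them tend to [tau s] and [tau t]. *)
Lemma arclength_param_lip1 : lip1 c (V b).
Proof.
move=> s t s0 st tV; have t0 := le_trans s0 st.
have /andP[as_ sb] := tau_itv s0; have /andP[at_ tb] := tau_itv t0.
rewrite -[c s]/(gamma (tau s)) -[c t]/(gamma (tau t)).
have := tau_homo s0 st; rewrite le_eqVlt => /predU1P[->|lst].
  by rewrite eucl_distxx subr_ge0.
apply/ler_addgt0Pr => e e0; have e20 : 0 < e / 2 by rewrite divr_gt0.
have /within_continuous_eucl H := gcont.
have [d d0 dP] := H (tau s) (tau_itv s0) _ e20.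
have [d' d'0 d'P] := H (tau t) (tau_itv t0) _ e20.
(* The midpoint keeps u <= v. *)
pose m := (tau s + tau t) / 2.
pose u := Num.min (tau s + d / 2) m; pose v := Num.max (tau t - d' / 2) m.
have um : u <= m by rewrite ge_min lexx orbT.
have mv : m <= v by rewrite le_max lexx orbT.
have su : tau s < u by rewrite lt_min; apply/andP; split; rewrite /m; lra.
have vt : v < tau t by rewrite gt_max; apply/andP; split; rewrite /m; lra.
have ud : `|u - tau s| < d.
  rewrite gtr0_norm ?subr_gt0// ltrBlDl.
  by rewrite gt_min; apply/orP; left; lra.
have vd : `|v - tau t| < d'.
  rewrite ltr0_norm ?subr_lt0// opprB ltrBlDr -ltrBlDl.
  by rewrite lt_max; apply/orP; left; lra.
have ub : u <= b by lra.
have au : a <= u by lra.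
have av : a <= v by lra.
have vb : v <= b by lra.
have h1 : eucl_dist (gamma (tau s)) (gamma u) < e / 2 by apply: dP => //; rewrite au.
have h2 : eucl_dist (gamma (tau t)) (gamma v) < e / 2 by apply: d'P => //; rewrite av.
have h3 : eucl_dist (gamma u) (gamma v) <= t - s.
  apply: (le_trans (eucl_dist_le_lengthB au (le_trans um mv) vb)).
  by rewrite lerB// ?tau_lt// ltW// tau_gt.
have := eucl_dist_triangle (gamma u) (gamma (tau s)) (gamma (tau t)).
have := eucl_dist_triangle (gamma v) (gamma u) (gamma (tau t)).
rewrite (eucl_distC (gamma v)) => h4 h5; lra.
Qed.

Lemma arclength_param_last : c (V b) = gamma b.
Proof.
congr (gamma _); apply/eqP; rewrite eq_le; apply/andP; split.
  apply: ge_sup; last by move=> t [/andP[]].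
  by exists b; split; rewrite ?ab ?lexx// fineK// rectifiable_sub_fin.
apply: ub_le_sup; first by exists b => t [/andP[]].
by split; rewrite ?ab ?lexx// fineK// rectifiable_sub_fin.
Qed.

(** [tau (V t)] may exceed t, but then gamma gains no length between the two, so it is constant
    there. *)
Lemma arclength_param_length t : a <= t <= b -> c (V t) = gamma t.
Proof.
move=> /andP[at_ tb]; have V0 : 0 <= V t by rewrite fine_ge0// curve_length_ge0.
have tt : t <= tau (V t).
  apply: ub_le_sup; first by case: (has_sup_S V0).
  by split; rewrite ?at_// fineK// rectifiable_sub_fin.
rewrite -[LHS]/(gamma (tau (V t))); have /andP[_ sb] := tau_itv V0.
move: tt; rewrite le_eqVlt => /predU1P[<-//|tt]; apply/esym/eucl_dist_le0.
apply/ler_addgt0Pr => e e0; rewrite add0r.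
have /within_continuous_eucl/(_ _ (tau_itv V0) _ e0)[d d0 dP] := gcont.
pose u := Num.max t (tau (V t) - d / 2).
have tu : t <= u by rewrite le_max lexx.
have us : u < tau (V t) by rewrite gt_max tt/=; lra.
have au : a <= u by exact: le_trans tu.
have ub : u <= b by lra.
have ud : `|u - tau (V t)| < d.
  rewrite ltr0_norm ?subr_lt0// opprB ltrBlDr -ltrBlDl.
  by rewrite lt_max; apply/orP; right; lra.
have h1 : eucl_dist (gamma (tau (V t))) (gamma u) < e by apply: dP => //; rewrite au.
have h2 := eucl_dist_le_lengthB at_ tu ub; have := tau_lt V0 au us => h3.
have := eucl_dist_triangle (gamma u) (gamma t) (gamma (tau (V t))).
rewrite (eucl_distC (gamma u) (gamma (tau (V t)))); lra.
Qed.

End param.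

End ArcLength.

(** * Comparison principle and quasihyperbolic length *)

(** Locked so that conversion does not unfold the Lebesgue integral; most estimates only use the
    bounds on increments [int0B_le] and [int0B_ge]. *)
HB.lock Definition int0 {R : realType} (f : R -> R) (t : R) : R :=
  \int[lebesgue_measure]_(x in `[0, t]) f x.

Section Comparison.
Context {R : realType}.
Implicit Types (f D : R -> R) (a b s t L M : R).

(* Cousin's lemma, by taking the supremum of the [t] up to which the bound
   [Phi a t <= e * (t - a)] holds. *)
Lemma subadditive_local_le0 a b (Phi : R -> R -> R) : a <= b ->
  (forall s t u, a <= s -> s <= t -> t <= u -> u <= b ->
     Phi s u <= Phi s t + Phi t u) ->
  (forall e, 0 < e -> forall t, a <= t <= b -> exists2 d : R, 0 < d &
     forall s u, a <= s -> s <= t -> t <= u -> u <= b -> t - d < s -> u < t + d ->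
     Phi s u <= e * (u - s)) ->
  Phi a b <= 0.
Proof.
move=> ab sub loc.
suff H e : 0 < e -> Phi a b <= e * (b - a).
  apply/ler_addgt0Pr => e e0; rewrite add0r.
  have d0 : 0 < b - a + 1 by rewrite ltr_wpDl// subr_ge0.
  apply: le_trans (H (e / (b - a + 1)) (divr_gt0 e0 d0)) _.
  by rewrite mulrAC ler_pdivrMr// ler_wpM2l ?lerDl// ltW.
move=> e0; pose A := [set t | a <= t <= b /\ Phi a t <= e * (t - a)].
have Aa : A a.
  split; first by rewrite lexx.
  have [|d d0 dP] := loc e e0 a; first by rewrite lexx.
  by apply: dP => //; lra.
have hA : has_sup A by split; [exists a|exists b => t [/andP[]]].
have aT : a <= sup A by apply: ub_le_sup => //; case: hA.
have Tb : sup A <= b by apply: ge_sup; [exists a|move=> t [/andP[]]].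
have [|d d0 dP] := loc e e0 (sup A); first by rewrite aT.
have [s [/andP[as_ sb] Ps] sT] := sup_adherent d0 hA.
have sT' : s <= sup A.
  by apply: ub_le_sup; [case: hA|split => //; rewrite as_].
pose u := Num.min b (sup A + d / 2).
have uT : sup A <= u by rewrite le_min Tb/=; lra.
have ub : u <= b by rewrite ge_min lexx.
have uTd : u < sup A + d by rewrite gt_min; apply/orP; right; lra.
have Pu : Phi a u <= e * (u - a).
  have := sub a s u (lexx _) as_ (le_trans sT' uT) ub.
  have := dP s u as_ sT' uT ub sT uTd => h1 h2; lra.
have uA : A u by split => //; rewrite ub (le_trans aT).
have : u <= sup A by apply: ub_le_sup => //; case: hA.
rewrite /u ge_min => /orP[bT|]; last by lra.
suff -> : b = u by [].
by rewrite /u min_l//; lra.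
Qed.

Notation mu := (@lebesgue_measure R).


Section int0.
Variables (f : R -> R) (L : R).
Hypothesis fc : {within `[0, L], continuous f}.

Lemma int0_integrable x : x <= L -> mu.-integrable `[0, x] (EFin \o f).
Proof.
move=> xL.
apply: integrableS (continuous_compact_integrable (@segment_compact _ 0 L) fc) => //.
by apply: subset_itvl; rewrite bnd_simp.
Qed.

Lemma int0E : (\int[mu]_(x in `[0%R, L]) (f x)%:E)%E = (int0 f L)%:E.
Proof. by rewrite int0.unlock fineK// integrable_fin_num// int0_integrable. Qed.

Let int0B x y : 0 <= x -> x <= y -> y <= L ->
  int0 f y - int0 f x = \int[mu]_(z in `]x, y]) f z.
Proof.
move=> x0 xy yL; rewrite int0.unlock Rintegral_itvB ?bnd_simp//.
exact: int0_integrable.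
Qed.

Let int_cst x y m : x <= y -> \int[mu]_(z in `]x, y]) m = m * (y - x).
Proof.
move=> xy; rewrite Rintegral_cst//.
rewrite [X in fine X](_ : _ = if x < y then (y - x)%:E else 0%E); last first.
  by apply: (etrans (@lebesgue_measure_itv R `]x, y])); rewrite /= lte_fin.
case: ltP => // yx; have -> : x = y by apply/eqP; rewrite eq_le xy.
by rewrite subrr.
Qed.

Let sub_integrable x y : 0 <= x -> x <= y -> y <= L -> mu.-integrable `]x, y] (EFin \o f).
Proof.
move=> x0 xy yL; apply: integrableS (int0_integrable yL) => //.
by apply: subset_itvr; rewrite bnd_simp.
Qed.

Let cst_integrable x y (m : R) : mu.-integrable `]x, y] (EFin \o cst m).
Proof.
have cc : {within `[x, y], continuous (cst m : R -> R)}.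
  by apply: continuous_subspaceT => ?; exact: cvg_cst.
apply: integrableS (continuous_compact_integrable (@segment_compact _ x y) cc) => //.
by apply: subset_itvr; rewrite bnd_simp.
Qed.

Lemma int0B_le x y M : 0 <= x -> x <= y -> y <= L ->
  (forall z, x <= z <= y -> f z <= M) -> int0 f y - int0 f x <= M * (y - x).
Proof.
move=> x0 xy yL H; rewrite int0B// -int_cst//; apply: le_Rintegral => //.
- exact: sub_integrable.
- exact: cst_integrable.
- by move=> z /=; rewrite in_itv/= => /andP[/ltW xz zy]; apply: H; rewrite xz.
Qed.

Lemma int0B_ge x y m : 0 <= x -> x <= y -> y <= L ->
  (forall z, x <= z <= y -> m <= f z) -> m * (y - x) <= int0 f y - int0 f x.
Proof.
move=> x0 xy yL H; rewrite int0B// -int_cst//; apply: le_Rintegral => //.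
- exact: cst_integrable.
- exact: sub_integrable.
- by move=> z /=; rewrite in_itv/= => /andP[/ltW xz zy]; apply: H; rewrite xz.
Qed.

Lemma int00 : int0 f 0 = 0.
Proof. by rewrite int0.unlock set_itv1 Rintegral_set1. Qed.

Let osc t e : 0 <= t <= L -> 0 < e -> exists2 d, 0 < d &
  forall s u, 0 <= s -> u <= L -> t - d < s -> u < t + d ->
   forall z, s <= z <= u -> f t - e <= f z <= f t + e.
Proof.
move=> t0L e0; have /within_continuous_real/(_ _ t0L _ e0)[d d0 dP] := fc.
exists d => // s u s0 uL ds ud z /andP[sz zu].
have : `|f t - f z| < e.
  apply: dP; first by rewrite (le_trans s0)//= (le_trans zu).
  by rewrite ltr_distl; apply/andP; split; lra.
by rewrite ltr_distl => /andP[h1 h2]; apply/andP; split; lra.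
Qed.

(** Near a point t the function f stays within e/2 of f t, so the integral over [s, u] exceeds the
    increment of D by at most e (u - s); [subadditive_local_le0] makes this global. D need not be
    differentiable or even continuous. *)
Lemma int0B_le_compare x y D : 0 <= x -> x <= y -> y <= L ->
  (forall s t m, x <= s -> s <= t -> t <= y ->
    (forall z, s <= z <= t -> m <= f z) -> m * (t - s) <= D t - D s) ->
  int0 f y - int0 f x <= D y - D x.
Proof.
move=> x0 xy yL HD; rewrite -subr_le0.
pose Phi s t := int0 f t - int0 f s - (D t - D s).
apply: (@subadditive_local_le0 x y Phi) => //.
  by move=> s t u _ _ _ _; rewrite /Phi; lra.
move=> e e0 t /andP[xt ty].
have [||d d0 dP] := @osc t (e / 2); first by rewrite (le_trans x0)//= (le_trans ty).
  by rewrite divr_gt0.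
exists d => // s u xs st tu uy ds ud.
have s0 := le_trans x0 xs; have uL := le_trans uy yL; have su := le_trans st tu.
have h1 : int0 f u - int0 f s <= (f t + e / 2) * (u - s).
  by apply: int0B_le => // z zP; have /andP[] := dP s u s0 uL ds ud z zP.
have h2 : (f t - e / 2) * (u - s) <= D u - D s.
  by apply: HD => // z zP; have /andP[] := dP s u s0 uL ds ud z zP.
rewrite /Phi; lra.
Qed.

Lemma int0B_ge_compare x y D : 0 <= x -> x <= y -> y <= L ->
  (forall s t M, x <= s -> s <= t -> t <= y ->
    (forall z, s <= z <= t -> f z <= M) -> D t - D s <= M * (t - s)) ->
  D y - D x <= int0 f y - int0 f x.
Proof.
move=> x0 xy yL HD; rewrite -subr_le0.
pose Phi s t := D t - D s - (int0 f t - int0 f s).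
apply: (@subadditive_local_le0 x y Phi) => //.
  by move=> s t u _ _ _ _; rewrite /Phi; lra.
move=> e e0 t /andP[xt ty].
have [||d d0 dP] := @osc t (e / 2); first by rewrite (le_trans x0)//= (le_trans ty).
  by rewrite divr_gt0.
exists d => // s u xs st tu uy ds ud.
have s0 := le_trans x0 xs; have uL := le_trans uy yL; have su := le_trans st tu.
have h1 : (f t - e / 2) * (u - s) <= int0 f u - int0 f s.
  by apply: int0B_ge => // z zP; have /andP[] := dP s u s0 uL ds ud z zP.
have h2 : D u - D s <= (f t + e / 2) * (u - s).
  by apply: HD => // z zP; have /andP[] := dP s u s0 uL ds ud z zP.
rewrite /Phi; lra.
Qed.

Hypothesis L0 : 0 <= L.

Lemma int0_le_compare D :
  (forall s t m, 0 <= s -> s <= t -> t <= L ->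
    (forall z, s <= z <= t -> m <= f z) -> m * (t - s) <= D t - D s) ->
  int0 f L <= D L - D 0.
Proof. by move/(int0B_le_compare (lexx _) L0 (lexx _)); rewrite int00 subr0. Qed.

Lemma int0_ge_compare D :
  (forall s t M, 0 <= s -> s <= t -> t <= L ->
    (forall z, s <= z <= t -> f z <= M) -> D t - D s <= M * (t - s)) ->
  D L - D 0 <= int0 f L.
Proof. by move/(int0B_ge_compare (lexx _) L0 (lexx _)); rewrite int00 subr0. Qed.

Lemma int0_le M : (forall z, 0 <= z <= L -> f z <= M) -> int0 f L <= M * L.
Proof. by move/(int0B_le (lexx _) L0 (lexx _)); rewrite int00 !subr0. Qed.

Lemma int0_ge m : (forall z, 0 <= z <= L -> m <= f z) -> m * L <= int0 f L.
Proof. by move/(int0B_ge (lexx _) L0 (lexx _)); rewrite int00 !subr0. Qed.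

End int0.
End Comparison.

Section QuasihyperbolicLength.
Context {R : realType} {n : nat} (Omega : set 'rV[R]_n).
Hypothesis Odom : domain Omega.
Hypothesis OT : Omega <> setT.
Local Notation delta := (delta Omega).
Local Notation k := (qh_dist Omega).
Implicit Types (x y z : 'rV[R]_n) (c gamma : R -> 'rV[R]_n) (L M : R).

Definition qh_density z : R := (delta z)^-1.
Local Notation rho := qh_density.

Lemma qh_density_gt0 z : Omega z -> 0 < rho z.
Proof. by move=> Oz; rewrite invr_gt0 delta_gt0. Qed.

Lemma qh_density_continuous z : Omega z -> {for z, continuous rho}.
Proof.
move=> Oz; apply: (@cvgV _ _ _ (nbhs_filter z)); last exact: (continuous_delta Odom OT).
by rewrite gt_eqF// delta_gt0.
Qed.

Definition curve_in c L := forall t, 0 <= t <= L -> Omega (c t).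

Lemma qh_density_curve_continuous c L : lip1 c L -> curve_in c L ->
  {within `[0, L], continuous (rho \o c)}.
Proof.
move=> /lip1_continuous/subspace_continuousP cl cO.
apply/subspace_continuousP => t tL; apply: cvg_comp; first exact: cl.
by apply: qh_density_continuous; apply: cO; move: tL; rewrite /= in_itv.
Qed.

Definition qh_length c L := int0 (rho \o c) L.

(** One half of the passage to 1-Lipschitz curves in the infimum defining k: every admissible curve
    yields one with the same integral. [line_integral_le_qh_length] is the other half. *)
Lemma line_integral_arclength gamma a b : rectifiable_curve_in Omega gamma a b ->
  let c := arclength_param gamma a b in let L := fine (curve_length gamma a b) in
  [/\ 0 <= L, lip1 c L, curve_in c L &
      line_integral rho gamma a b = (qh_length c L)%:E].
Proof.
move=> [ab gc gO gfin] c L.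
have cl : lip1 c L by exact: arclength_param_lip1.
have cO : curve_in c L.
  move=> t /andP[t0 _].
  have [u uab cu] := arclength_param_in_image gamma ab t0.
  by rewrite /c cu; apply: gO; rewrite in_itv.
split => //; first by rewrite fine_ge0// curve_length_ge0.
by rewrite /line_integral -/L /qh_length -int0E//; exact: qh_density_curve_continuous.
Qed.

Lemma qh_length_ge0 c L : 0 <= L -> curve_in c L -> 0 <= qh_length c L.
Proof.
move=> L0 cO; rewrite /qh_length int0.unlock; apply: Rintegral_ge0 => t; rewrite /= in_itv/= => tL.
by rewrite ltW// qh_density_gt0//; exact: cO.
Qed.

(* Reparametrizing by arc length cannot increase the integral, since a
   1-Lipschitz curve is traversed with speed at most 1. *)
Lemma line_integral_le_qh_length c L : 0 <= L -> lip1 c L -> curve_in c L ->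
  (line_integral rho c 0 L <= (qh_length c L)%:E)%E.
Proof.
move=> L0 cl cO; have crect := lip1_rectifiable L0 cl cO.
have [ _ ccont _ cfin] := crect.
have /= := line_integral_arclength crect.
set c' := arclength_param c 0 L; set L' := fine _; move=> [L'0 c'l c'O ->].
rewrite lee_fin /qh_length; pose V t := fine (curve_length c 0 t).
have VB s t : 0 <= s -> s <= t -> t <= L -> V t - V s <= t - s.
  move=> s0 st tL; rewrite (@fine_curve_lengthB _ _ c 0 L)// -lee_fin.
  by rewrite fineK ?(@rectifiable_sub_fin _ _ c 0 L)//; exact: lip1_length tL.
have Vh s t : 0 <= s -> s <= t -> t <= L -> V s <= V t.
  by move=> s0 st tL; apply: (@fine_curve_length_homo _ _ c 0 L).
have V0 : V 0 = 0 by rewrite /V curve_lengthxx.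
have Vcont : {within `[0, L], continuous V}.
  apply/within_continuous_real => t /andP[t0 tL] e e0; exists e => // u /andP[u0 uL] tu.
  apply: le_lt_trans tu; have [ut|/ltW ut] := leP t u.
    have := VB _ _ t0 ut uL; have := Vh _ _ t0 ut uL => h1 h2.
    by rewrite distrC !ger0_norm ?subr_ge0.
  have := VB _ _ u0 ut tL; have := Vh _ _ u0 ut tL => h1 h2.
  by rewrite [leRHS]distrC !ger0_norm ?subr_ge0.
have c'cont := qh_density_curve_continuous c'l c'O.
have ccont' := qh_density_curve_continuous cl cO.
(* On [s, t] the increment of D is an integral over [V s, V t]. By the intermediate value theorem
   each c' v with v in that interval is some c u with u in [s, t], so a bound M for the density
   along c also holds along c', and V t - V s <= t - s. *)
apply: le_trans (int0_ge_compare ccont' L0 (D := fun t => int0 (rho \o c') (V t)) _).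
  by rewrite V0 int00 subr0.
move=> s t M s0 st tL HM.
have V0s : 0 <= V s by rewrite -V0 Vh// (le_trans st).
apply: (@le_trans _ _ (M * (V t - V s))).
  apply: (int0B_le c'cont) => //; first exact: Vh.
    by apply: Vh => //; exact: le_trans st.
  move=> v /andP[sv vt].
  have [||u + <-] := @IVT _ V s t v st.
  - apply: continuous_subspaceW Vcont => w; rewrite /= !in_itv/= => /andP[sw wt].
    by rewrite (le_trans s0)//= (le_trans wt).
  - by rewrite ge_min sv le_max vt orbT.
  rewrite in_itv/= => uin; have /andP[su ut] := uin.
  rewrite /= /c' /V (@arclength_param_length _ _ c 0 L)//; first exact: HM.
  by rewrite (le_trans s0)//= (le_trans ut).
rewrite ler_wpM2l//; last by apply: VB.
apply: le_trans (HM s _); last by rewrite lexx.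
by rewrite ltW// qh_density_gt0//; apply: cO; rewrite s0 (le_trans st).
Qed.

End QuasihyperbolicLength.

(** * The quasihyperbolic metric *)

Section QuasihyperbolicDistance.
Context {R : realType} {n : nat} (Omega : set 'rV[R]_n).
Hypothesis Odom : domain Omega.
Hypothesis OT : Omega <> setT.
Local Notation delta := (delta Omega).
Local Notation k := (qh_dist Omega).
Local Notation rho := (qh_density Omega).
Local Notation qhlen := (qh_length Omega).
Implicit Types (x y z : 'rV[R]_n) (c gamma : R -> 'rV[R]_n) (L M e r : R).

Definition curve_between x y c L :=
  [/\ 0 <= L, lip1 c L, curve_in Omega c L, c 0 = x & c L = y].

Let concat c1 L1 c2 t := if t <= L1 then c1 t else c2 (t - L1).

Lemma curve_concat x y z c1 L1 c2 L2 :
  curve_between x y c1 L1 -> curve_between y z c2 L2 ->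
  exists2 c, curve_between x z c (L1 + L2) &
             qhlen c (L1 + L2) <= qhlen c1 L1 + qhlen c2 L2.
Proof.
move=> [L10 l1 in1 c10 c1L] [L20 l2 in2 c20 c2L].
pose c := concat c1 L1 c2.
have L120 : 0 <= L1 + L2 by rewrite addr_ge0.
have cr t : L1 <= t -> c t = c2 (t - L1).
  rewrite /c /concat le_eqVlt => /predU1P[<-|L1t].
    by rewrite lexx subrr c1L c20.
  by rewrite leNgt L1t.
have cl t : t <= L1 -> c t = c1 t by rewrite /c /concat => ->.
have ccl : lip1 c (L1 + L2).
  move=> s t s0 st tL; have [tL1|/ltW L1t] := leP t L1.
    by rewrite !cl// ?(le_trans st)// l1.
  have [sL1|/ltW L1s] := leP s L1; last first.
    rewrite !cr// (le_trans (l2 _ _ _ _ _))//; lra.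
  apply: le_trans (eucl_dist_triangle (c L1) _ _) _.
  have -> : t - s = (L1 - s) + (t - L1) by ring.
  rewrite lerD//; first by rewrite !cl// l1.
  rewrite !cr// (le_trans (l2 _ _ _ _ _))//; lra.
have cin : curve_in Omega c (L1 + L2).
  move=> t /andP[t0 tL]; have [tL1|/ltW L1t] := leP t L1.
    by rewrite cl//; apply: in1; rewrite t0.
  by rewrite cr//; apply: in2; apply/andP; split; lra.
exists c.
  by split => //; [rewrite cl|rewrite cr ?lerDl// addrAC subrr add0r].
have cc := qh_density_curve_continuous Odom OT ccl cin.
have cc1 := qh_density_curve_continuous Odom OT l1 in1.
have cc2 := qh_density_curve_continuous Odom OT l2 in2.
have L1L12 : L1 <= L1 + L2 by rewrite lerDl.
rewrite /qh_length -[leLHS](subrKC (int0 (rho \o c) L1)); apply: lerD.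
  have cc' : {within `[0, L1], continuous (rho \o c)}.
    by apply: continuous_subspaceW cc; apply: subset_itvl; rewrite bnd_simp.
  have := int0_le_compare cc' L10 (D := int0 (rho \o c1)); rewrite int00 subr0.
  apply=> s t m s0 st tL1 H; apply: (int0B_ge cc1 s0 st tL1) => w /andP[sw wt].
  by have := H w; rewrite sw wt /= cl ?(le_trans wt)//; apply.
have := int0B_le_compare cc L10 L1L12 (lexx _) (D := fun t => int0 (rho \o c2) (t - L1)).
rewrite subrr (int00 (rho \o c2)) subr0 [L1 + L2 - L1]addrAC subrr add0r; apply=> s t m s0 st tL1 H.
have -> : t - s = (t - L1) - (s - L1) by ring.
apply: (int0B_ge cc2); [lra|lra|lra|] => w /andP[sw wt].
have := H (w + L1); rewrite /= cr ?addrK; last lra.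
by apply; apply/andP; split; lra.
Qed.

Lemma curve_sub c L s t : lip1 c L -> curve_in Omega c L ->
  0 <= s -> s <= t -> t <= L ->
  exists2 c', curve_between (c s) (c t) c' (t - s) &
     qhlen c' (t - s) <= int0 (rho \o c) t - int0 (rho \o c) s.
Proof.
move=> cl cin s0 st tL; pose c' u := c (s + u); exists c'.
  split; rewrite /c' ?subr_ge0 ?addr0// ?subrKC//.
  - move=> u v u0 uv vt; rewrite (le_trans (cl _ _ _ _ _))//; lra.
  - by move=> u /andP[u0 us]; apply: cin; apply/andP; split; lra.
have cc := qh_density_curve_continuous Odom OT cl cin.
have cl' : lip1 c' (t - s).
  move=> u v u0 uv vt; rewrite /c' (le_trans (cl _ _ _ _ _))//; lra.
have cin' : curve_in Omega c' (t - s).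
  by move=> u /andP[u0 us]; apply: cin; apply/andP; split; lra.
have cc' := qh_density_curve_continuous Odom OT cl' cin'.
have ts0 : 0 <= t - s by rewrite subr_ge0.
have := int0_le_compare cc' ts0 (D := fun u => int0 (rho \o c) (s + u)).
rewrite addr0 subrKC; apply=> u v m u0 uv vt H; have -> : v - u = (s + v) - (s + u) by ring.
apply: (int0B_ge cc); [lra|lra|lra|] => w /andP[uw wv].
by have := H (w - s); rewrite /= /c' subrKC; apply; apply/andP; split; lra.
Qed.

Lemma curve_rev x y c L : curve_between x y c L ->
  exists2 c', curve_between y x c' L & qhlen c' L <= qhlen c L.
Proof.
move=> [L0 cl cin c0 cL]; pose c' u := c (L - u); exists c'.
  split; rewrite /c' ?subr0 ?subrr//.
  - move=> u v u0 uv vt; rewrite eucl_distC (le_trans (cl _ _ _ _ _))//; lra.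
  - by move=> u /andP[u0 us]; apply: cin; apply/andP; split; lra.
have cc := qh_density_curve_continuous Odom OT cl cin.
have cl' : lip1 c' L.
  move=> u v u0 uv vt; rewrite /c' eucl_distC (le_trans (cl _ _ _ _ _))//; lra.
have cin' : curve_in Omega c' L.
  by move=> u /andP[u0 us]; apply: cin; apply/andP; split; lra.
have cc' := qh_density_curve_continuous Odom OT cl' cin'.
have := int0_le_compare cc' L0 (D := fun u => - int0 (rho \o c) (L - u)).
rewrite subrr int00 subr0 oppr0 sub0r opprK; apply=> u v m u0 uv vt H.
have -> : v - u = (L - u) - (L - v) by ring.
rewrite opprK [leRHS]addrC.
apply: (int0B_ge cc); [lra|lra|lra|] => w /andP[uw wv].
have := H (L - w); rewrite /= /c' subKr.
by apply; apply/andP; split; lra.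
Qed.

Lemma curve_segment x y : Omega x -> eucl_dist x y < delta x ->
  exists2 c, curve_between x y c (eucl_dist x y) &
    qhlen c (eucl_dist x y) <= eucl_dist x y / (delta x - eucl_dist x y).
Proof.
move=> Ox xyd; set r := eucl_dist x y in xyd *.
have r0 : 0 <= r by exact: eucl_dist_ge0.
(* If r = 0, the quotient is 0 by convention and the curve is constant. *)
pose c (t : R) := x + (t / r) *: (y - x).
have cd s t : eucl_dist (c s) (c t) <= `|s - t|.
  rewrite /c eucl_dist_line -/r -mulrBl normrM -mulrA ler_piMr//.
  have [->|rn0] := eqVneq r 0; first by rewrite mulr0.
  by rewrite ger0_norm ?invr_ge0// mulVf.
have xc t : 0 <= t <= r -> eucl_dist x (c t) <= r.
  move=> /andP[t0 tr]; have -> : x = c 0 by rewrite /c mul0r scale0r addr0.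
  by rewrite (le_trans (cd _ _))// sub0r normrN ger0_norm.
have cin : curve_in Omega c r.
  by move=> t /xc tr; apply: (delta_ball Odom OT Ox); exact: le_lt_trans xyd.
have cl : lip1 c r.
  by move=> s t s0 st tL; rewrite (le_trans (cd _ _))// distrC ger0_norm// subr_ge0.
exists c.
  split => //; first by rewrite /c mul0r scale0r addr0.
  rewrite /c; have [rz|rn0] := eqVneq r 0.
    by rewrite (eucl_dist_le0 (y := y) (x := x)) ?subrr ?scaler0 ?addr0// -/r rz.
  by rewrite divff// scale1r subrKC.
have cc := qh_density_curve_continuous Odom OT cl cin.
rewrite mulrC; apply: (int0_le cc r0) => t tr.
rewrite /= /qh_density lef_pV2 ?posrE ?subr_gt0 ?delta_gt0//; last exact: cin.
have := delta_lip Odom OT x (c t); have := xc _ tr; lra.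
Qed.

(** The set of points reachable from x is open and closed in the connected Omega. This makes the
    infimum defining k finite on Omega, so that [fine] loses nothing there. *)
Lemma curve_exists x y : Omega x -> Omega y -> exists c L, curve_between x y c L.
Proof.
move=> Ox Oy; pose E := [set y | Omega y /\ exists c L, curve_between x y c L].
case: Odom => Oop Oconn _.
have ext u v : E u -> eucl_dist u v < delta u -> E v.
  move=> [Ou [c [L cP]]] uv; split; first exact: (delta_ball Odom OT Ou).
  have [c' c'P _] := curve_segment Ou uv.
  by have [c'' c''P _] := curve_concat cP c'P; exists c'', (L + eucl_dist u v).
suff : E = Omega by move=> EO; have [] : E y by rewrite EO.
apply: Oconn.
- exists x; split => //; exists (fun=> x), 0; split => //.
  by move=> s t s0 st t0; rewrite eucl_distxx subr_ge0.
- exists E; last by apply/seteqP; split => [u [? ?]//|u []].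
  rewrite openE => u Eu; apply/nbhs_eucl; exists (delta u) => [|v]; last exact: ext.
  by rewrite (delta_gt0 Odom OT)//; case: Eu.
- exists (closure E); first exact: closed_closure.
  apply/seteqP; split => [u Eu|u [Ou Eu]].
    by split; [case: Eu|exact: subset_closure].
  have d0 := delta_gt0 Odom OT Ou.
  have [|v /= [Ev uv]] := Eu [set v | eucl_dist u v < delta u / 2].
    by apply/nbhs_eucl; exists (delta u / 2) => //; rewrite divr_gt0.
  apply: (ext v) => //; have := delta_lip Odom OT u v.
  by rewrite (eucl_distC v); lra.
Qed.

Let einf x y := ereal_inf [set l | exists gamma a b,
    [/\ rectifiable_curve_in Omega gamma a b, gamma a = x, gamma b = y &
        l = line_integral (fun z => (delta z)^-1) gamma a b]].

Let einf_ge0 x y : (0 <= einf x y)%E.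
Proof.
apply: le_ereal_inf_tmp => _ [g [a [b [rg _ _ ->]]]].
have [L0 _ cin ->] := line_integral_arclength Odom OT rg.
by rewrite lee_fin qh_length_ge0.
Qed.

Let einf_le x y c L : curve_between x y c L -> (einf x y <= (qhlen c L)%:E)%E.
Proof.
move=> [L0 cl cin c0 cL].
apply: le_trans (line_integral_le_qh_length Odom OT L0 cl cin).
apply: ereal_inf_lbound; exists c, 0, L; split => //; exact: lip1_rectifiable.
Qed.

Let einf_fin x y : Omega x -> Omega y -> einf x y \is a fin_num.
Proof.
move=> Ox Oy; rewrite ge0_fin_numE//; have [c [L cP]] := curve_exists Ox Oy.
by apply: le_lt_trans (einf_le cP) _; rewrite ltry.
Qed.

Lemma curve_between_in x y c L : curve_between x y c L -> Omega x /\ Omega y.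
Proof.
by move=> [L0 _ cin <- <-]; split; apply: cin; rewrite ?lexx ?L0.
Qed.

Lemma qh_dist_le_length x y c L : curve_between x y c L -> k x y <= qhlen c L.
Proof.
move=> cP; have [Ox Oy] := curve_between_in cP.
by rewrite -lee_fin /qh_dist fineK ?einf_fin// einf_le.
Qed.

Lemma qh_dist_ge0 x y : 0 <= k x y.
Proof. by rewrite fine_ge0// einf_ge0. Qed.

Lemma qh_dist_approx x y e : Omega x -> Omega y -> 0 < e ->
  exists c L, curve_between x y c L /\ qhlen c L <= k x y + e.
Proof.
move=> Ox Oy e0; have [_ [g [a [b [rg ga gb ->]]]]] := lb_ereal_inf_adherent e0 (einf_fin Ox Oy).
have [ab gcont gin gfin] := rg.
have [L0 cl cin ->] := line_integral_arclength Odom OT rg.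
move=> H.
exists (arclength_param g a b), (fine (curve_length g a b)); split.
  split => //.
    have := arclength_param_length ab gcont gfin (t := a).
    by rewrite curve_lengthxx /= lexx ab => ->.
  by rewrite arclength_param_last.
by rewrite -lee_fin EFinD /qh_dist (fineK (einf_fin Ox Oy)) ltW.
Qed.

Lemma qh_dist_triangle y x z : Omega x -> Omega y -> Omega z ->
  k x z <= k x y + k y z.
Proof.
move=> Ox Oy Oz; apply/ler_addgt0Pr => e e0.
have e20 : 0 < e / 2 by rewrite divr_gt0.
have [c1 [L1 [c1P h1]]] := qh_dist_approx Ox Oy e20.
have [c2 [L2 [c2P h2]]] := qh_dist_approx Oy Oz e20.
have [c cP h] := curve_concat c1P c2P.
apply: le_trans (qh_dist_le_length cP) _; apply: le_trans h _.
by rewrite (splitr e) addrACA; exact: lerD.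
Qed.

Let qh_dist_sym_le x y : Omega x -> Omega y -> k y x <= k x y.
Proof.
move=> Ox Oy; apply/ler_addgt0Pr => e e0.
have [c1 [L1 [c1P h1]]] := qh_dist_approx Ox Oy e0.
have [c cP h] := curve_rev c1P.
exact: le_trans (le_trans (qh_dist_le_length cP) h) h1.
Qed.

Lemma qh_distC x y : Omega x -> Omega y -> k x y = k y x.
Proof. by move=> Ox Oy; apply/eqP; rewrite eq_le !qh_dist_sym_le. Qed.

Lemma qh_dist_le_eucl x y : Omega x -> eucl_dist x y < delta x ->
  k x y <= eucl_dist x y / (delta x - eucl_dist x y).
Proof.
move=> Ox xy; have [c cP] := curve_segment Ox xy.
exact: le_trans (qh_dist_le_length cP).
Qed.

Lemma qh_distxx x : Omega x -> k x x = 0.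
Proof.
move=> Ox; apply/eqP; rewrite eq_le qh_dist_ge0 andbT.
by have := @qh_dist_le_eucl x x Ox; rewrite eucl_distxx mul0r; apply; exact: delta_gt0.
Qed.

(** On a 1-Lipschitz curve on [0, L] starting at x, delta is at most delta x + L, so its
    quasihyperbolic length is at least L / (delta x + L). This increases with L, and L >= |x -
    y|. *)
Lemma qh_dist_ge_eucl x y : Omega x -> Omega y ->
  eucl_dist x y <= k x y * (delta x + eucl_dist x y).
Proof.
move=> Ox Oy; have r0 := eucl_dist_ge0 x y; have d0 := delta_gt0 Odom OT Ox.
have dr0 : 0 < delta x + eucl_dist x y by rewrite ltr_pwDl.
rewrite -ler_pdivrMr//; apply/ler_addgt0Pr => e e0.
have [c [L [[L0 cl cin c0 cL] h]]] := qh_dist_approx Ox Oy e0.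
apply: le_trans h; have rL : eucl_dist x y <= L.
  by rewrite -c0 -cL (le_trans (cl _ _ _ _ _))// subr0.
have dL0 : 0 < delta x + L by rewrite ltr_pwDl.
apply: (@le_trans _ _ (L / (delta x + L))).
  rewrite ler_pdivrMr// mulrAC ler_pdivlMr//; nra.
have cc := qh_density_curve_continuous Odom OT cl cin.
rewrite mulrC; apply: (int0_ge cc L0) => t /andP[t0 tL].
have ct : Omega (c t) by apply: cin; rewrite t0.
rewrite /= /qh_density lef_pV2 ?posrE ?delta_gt0//.
have := delta_lip Odom OT (c t) x; have := cl 0 t (lexx _) t0 tL.
rewrite c0 eucl_distC; lra.
Qed.

Lemma qh_dist_le0 x y : Omega x -> Omega y -> k x y <= 0 -> x = y.
Proof.
move=> Ox Oy xy; apply: eucl_dist_le0; apply: le_trans (qh_dist_ge_eucl Ox Oy) _.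
have kxy : k x y = 0 by apply/eqP; rewrite eq_le xy qh_dist_ge0.
by rewrite kxy mul0r.
Qed.

Lemma qh_dist_sub_curve c L s t : lip1 c L -> curve_in Omega c L ->
  0 <= s -> s <= t -> t <= L ->
  k (c s) (c t) <= int0 (rho \o c) t - int0 (rho \o c) s.
Proof.
move=> cl cin s0 st tL; have [c' c'P] := curve_sub cl cin s0 st tL.
exact: le_trans (qh_dist_le_length c'P).
Qed.

Lemma qh_dist_le_bounded_density gamma a b M : rectifiable_curve_in Omega gamma a b ->
  (forall t, a <= t <= b -> rho (gamma t) <= M) ->
  k (gamma a) (gamma b) <= M * fine (curve_length gamma a b).
Proof.
move=> rg HM; have [ab gcont gin gfin] := rg.
have [L0 cl cin _] := line_integral_arclength Odom OT rg.
set c := arclength_param gamma a b in cl cin *.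
set L := fine (curve_length gamma a b) in L0 cl cin *.
have ca : c 0 = gamma a.
  have := arclength_param_length ab gcont gfin (t := a).
  by rewrite /c curve_lengthxx /= lexx ab => ->.
have cb : c L = gamma b by exact: arclength_param_last.
have cP : curve_between (gamma a) (gamma b) c L by split.
apply: le_trans (qh_dist_le_length cP) _.
have cc := qh_density_curve_continuous Odom OT cl cin.
apply: (int0_le cc L0) => t /andP[t0 tL].
by have [u uab cu] := arclength_param_in_image gamma ab t0; rewrite /= /c cu HM.
Qed.

(** An almost shortest curve is reparametrized by its quasihyperbolic length J and stopped at J = k
    x y; at most e of it remains. A choice u of preimages under J serves as inverse. *)
Lemma rough_geodesic x y e : Omega x -> Omega y -> 0 < e ->
  exists z : R -> 'rV[R]_n,
    [/\ forall s, 0 <= s <= k x y -> Omega (z s), k x (z 0) <= e,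
        k (z (k x y)) y <= e &
        forall s t, 0 <= s -> s <= t -> t <= k x y -> k (z s) (z t) <= t - s].
Proof.
move=> Ox Oy e0; have [c [L [cP h]]] := qh_dist_approx Ox Oy e0.
have [L0 cl cin c0 cL] := cP; set T := k x y.
have cc := qh_density_curve_continuous Odom OT cl cin.
pose J := int0 (rho \o c).
have J0 : J 0 = 0 by rewrite /J int00.
have TJ : T <= J L by exact: qh_dist_le_length.
have Jh s t : 0 <= s -> s <= t -> t <= L -> J s <= J t.
  move=> s0 st tL; rewrite -subr_ge0; apply: le_trans (qh_dist_sub_curve cl cin s0 st tL).
  exact: qh_dist_ge0.
have Jc : {within `[0, L], continuous J}.
  rewrite /J int0.unlock; apply: parameterized_integral_continuous => //.
  exact: int0_integrable.
have /choice[u uP] : forall s, exists u, 0 <= s <= T -> 0 <= u <= L /\ J u = s.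
  move=> s; have [sT|nsT] := boolP (0 <= s <= T); last by exists 0.
  have /andP[s0 sT'] := sT.
  have [||u] := @IVT _ J 0 L s L0 => //.
    by rewrite J0 ge_min s0/= le_max (le_trans sT' TJ) orbT.
  by rewrite in_itv/= => ? <-; exists u.
have T0 : 0 <= T by exact: qh_dist_ge0.
have uh s t : 0 <= s -> s <= t -> t <= T -> k (c (u s)) (c (u t)) <= t - s.
  move=> s0 st tT; have [/andP[us0 usL] Js] := uP s (introT andP (conj s0 (le_trans st tT))).
  have [/andP[ut0 utL] Jt] := uP t (introT andP (conj (le_trans s0 st) tT)).
  rewrite -[in leRHS]Js -[in leRHS]Jt.
  (* The choice u is not known to be monotone; where it reverses the order, monotonicity of J forces
     s = t. *)
  have [ust|/ltW uts] := leP (u s) (u t); first exact: qh_dist_sub_curve cl cin us0 ust utL.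
  have -> : t = s.
    apply/eqP; rewrite eq_le st andbT -[in leLHS]Jt -[in leRHS]Js.
    exact: Jh ut0 uts usL.
  by rewrite Js subrr qh_distxx//; apply: cin; rewrite us0.
have b0 : (0 : R) <= 0 <= T by rewrite lexx T0.
have bT : 0 <= T <= T by rewrite T0 lexx.
have [/andP[u00 u0L] Ju0] := uP 0 b0; have [/andP[uT0 uTL] JuT] := uP T bT.
exists (c \o u); split => /=.
- by move=> s /uP[uL _]; exact: cin.
- rewrite -[in k x _]c0; apply: le_trans (qh_dist_sub_curve cl cin (lexx _) u00 u0L) _.
  by rewrite -/(J _) -/(J _) Ju0 J0 subrr ltW.
- rewrite -[in k _ y]cL; apply: le_trans (qh_dist_sub_curve cl cin uT0 uTL (lexx _)) _.
  by rewrite -/(J _) -/(J _) JuT lerBlDl.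
- exact: uh.
Qed.

End QuasihyperbolicDistance.

(** * Compactness and geodesics *)

(** For an ultrafilter a cluster point is a limit. A single ultrafilter on the indices thus gives
    limits for all parameters of a family of curves at once, without extracting subsequences. *)
Lemma ultra_compact_cvg (I : Type) (T : topologicalType) (U : set_system I)
    (A : set T) (f : I -> T) : UltraFilter U -> compact A -> U (f @^-1` A) ->
  exists2 p, A p & f @ U --> p.
Proof.
move=> UU cA UA; have [p [Ap clp]] := cA (f @ U) _ UA.
exists p => // N Np; rewrite /= nbhs_simpl /=.
have [//|nN] := in_ultra_setVsetC (f @^-1` N) UU.
by have [q [/=]] := clp _ _ (nN : (f @ U) (~` N)) Np.
Qed.

Section QuasihyperbolicGeometry.
Context {R : realType} {n : nat} (Omega : set 'rV[R]_n).
Hypothesis Odom : domain Omega.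
Hypothesis OT : Omega <> setT.
Local Notation delta := (delta Omega).
Local Notation k := (qh_dist Omega).
Implicit Types (w x y z p : 'rV[R]_n) (gamma : R -> 'rV[R]_n) (e r T : R).

Let k0 := qh_dist_ge0 Odom OT.
Let kC := qh_distC Odom OT.
Let kxx := qh_distxx Odom OT.
Let kT := qh_dist_triangle Odom OT.

Lemma qh_dist_near x e : Omega x -> 0 < e -> exists2 d : R, 0 < d &
  forall y, eucl_dist x y < d -> Omega y /\ k x y < e.
Proof.
move=> Ox e0; have d0 := delta_gt0 Odom OT Ox.
exists (Num.min (delta x / 2) (e * (delta x / 3))) => [|y].
  by rewrite lt_min divr_gt0//= mulr_gt0// divr_gt0.
rewrite lt_min => /andP[h1 h2]; have xy : eucl_dist x y < delta x by lra.
split; first exact: (delta_ball Odom OT Ox).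
apply: le_lt_trans (qh_dist_le_eucl Odom OT Ox xy) _.
rewrite ltr_pdivrMr ?subr_gt0//; apply: lt_le_trans h2 _.
by rewrite ler_pM2l//; lra.
Qed.

Lemma eucl_dist_near x e : Omega x -> 0 < e -> exists2 d : R, 0 < d &
  forall y, Omega y -> k x y < d -> eucl_dist x y < e.
Proof.
move=> Ox e0; have d0 := delta_gt0 Odom OT Ox.
have de0 : 0 < delta x + e by rewrite addr_gt0.
exists (e / (delta x + e)) => [|y Oy]; first by rewrite divr_gt0.
rewrite ltr_pdivlMr// => kxy; rewrite ltNge; apply/negP => er.
have := qh_dist_ge_eucl Odom OT Ox Oy.
move: (eucl_dist x y) (k x y) (k0 x y) kxy er => r q q0 h1 h2 h3.
have q1 : q <= 1 by rewrite leNgt; apply/negP => q1; nra.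
nra.
Qed.

(** |u - v| <= (delta u + |u - v|) / 3 gives |u - v| <= delta u / 2, whence the threshold 1/3. *)
Let short_step u v : Omega u -> Omega v -> k u v <= 1 / 3 ->
  delta u / 2 <= delta v /\ eucl_dist u v <= delta u.
Proof.
move=> Ou Ov uv; have d0 := delta_gt0 Odom OT Ou.
have h := qh_dist_ge_eucl Odom OT Ou Ov; have := delta_lip Odom OT u v.
have := eucl_dist_ge0 u v; move: (eucl_dist u v) (k u v) uv h => r q h1 h2 h3 h4.
have h5 : q * (delta u + r) <= (1 / 3) * (delta u + r) by rewrite ler_wpM2r// addr_ge0// ltW.
split; lra.
Qed.

(** Induction on the radius in steps of 1/4: a point of the larger ball is one short step away from
    the smaller ball, and such a step at worst halves [delta]. *)
Lemma qh_ball_delta w (N : nat) : Omega w -> exists c M : R, 0 < c /\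
  forall z, Omega z -> k w z <= N%:R / 4 -> c <= delta z /\ eucl_dist w z <= M.
Proof.
move=> Ow; elim: N => [|N [c [M [c0 IH]]]].
  exists (delta w), 0; split; first exact: delta_gt0.
  by move=> z Oz; rewrite mul0r => /(qh_dist_le0 Odom OT Ow Oz) <-; rewrite eucl_distxx.
(* The last step has Euclidean length at most delta u <= delta w + |w - u| <= delta w + M. *)
exists (c / 2), (M + (delta w + M)); split; first by rewrite divr_gt0.
move=> z Oz kz.
suff [u [Ou ku uz]] : exists u, [/\ Omega u, k w u <= N%:R / 4 & k u z <= 1 / 3].
  have [cu uM] := IH u Ou ku; have [h1 h2] := short_step Ou Oz uz.
  have h3 := delta_lip Odom OT u w; have := eucl_dist_triangle u w z.
  by move: h3; rewrite (eucl_distC u w) => h3 h4; split; lra.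
have [T3|T3] := leP (k w z) (3 / 10).
  by exists w; split; [|rewrite kxx// divr_ge0|lra].
(* Going back by 3/10 along a rough geodesic with error 1/100 gains at least 1/4, and the step that
   remains is at most 1/3. *)
have e0 : 0 < 1 / 100 :> R by lra.
have [g [gO g0 gT gl]] := rough_geodesic Odom OT Ow Oz e0.
move: (k w z) kz T3 gO g0 gT gl => T kz T3 gO g0 gT gl.
have T0 : 0 <= T - 3 / 10 by lra.
have TT : T - 3 / 10 <= T by lra.
have O0 : Omega (g 0) by apply: gO; apply/andP; split; lra.
have OTT : Omega (g T) by apply: gO; apply/andP; split; lra.
have Ou : Omega (g (T - 3 / 10)) by apply: gO; apply/andP; split; lra.
exists (g (T - 3 / 10)); split => //.
  apply: le_trans (kT Ow O0 Ou) _; apply: le_trans (lerD g0 (gl _ _ (lexx _) T0 TT)) _.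
  by move: kz; rewrite -natr1; lra.
apply: le_trans (kT Ou OTT Oz) _; apply: le_trans (lerD (gl _ _ T0 TT (lexx _)) gT) _.
lra.
Qed.

Lemma qh_ball_bounds w r : Omega w -> exists c M : R, 0 < c /\
  forall z, Omega z -> k w z <= r -> c <= delta z /\ eucl_dist w z <= M.
Proof.
move=> Ow; have [c [M [c0 H]]] := qh_ball_delta (Num.truncn (`|r| * 4)).+1 Ow.
exists c, M; split => // z Oz kz; apply: H => //; apply: le_trans kz _.
rewrite ler_pdivlMr//; apply: le_trans (ltW (Num.Theory.truncnS_gt _)).
by rewrite ler_wpM2r// ler_norm.
Qed.

Lemma compact_qh_ball w r : Omega w -> compact [set z | Omega z /\ k w z <= r].
Proof.
move=> Ow; have [c [M [c0 H]]] := qh_ball_bounds r Ow.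
apply: (@compact_eucl_bounded _ _ _ w M) => [z cz|z [Oz kz]]; last first.
  by rewrite eucl_distC; case: (H z Oz kz).
have [Oz _] : Omega z /\ c <= delta z.
  by apply: (closure_delta_ge Odom OT c0 _ cz) => u [Ou ku]; case: (H u Ou ku).
split => //; apply/ler_addgt0Pr => e e0.
have [d d0 dP] := qh_dist_near Oz e0.
have [|u /= [[Ou ku] uz]] := cz [set u | eucl_dist z u < d].
  by apply/nbhs_eucl; exists d.
have [_ zu] := dP u uz; apply: le_trans (kT Ow Ou Oz) _.
by rewrite lerD// kC// ltW.
Qed.

Lemma qh_dist_bounded_compact w (K : set 'rV[R]_n) : Omega w -> compact K ->
  K `<=` Omega -> exists M, forall z, K z -> k w z <= M.
Proof.
move=> Ow cK KO.
suff : \forall M \near +oo, K `<=` (fun z => k w z <= M).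
  by move=> /filter_ex[M MP]; exists M.
apply: ((compact_near_coveringP K).1 cK) => x /KO Ox.
have [d d0 dP] := qh_dist_near Ox ltr01.
exists ([set u | eucl_dist x u < d], [set M : R | k w x + 1 < M]).
  split; first by apply/nbhs_eucl; exists d.
  by exists (k w x + 1); split => //; exact: num_real.
move=> [u M] /= [/dP[Ou xu] kM]; apply: le_trans (kT Ow Ox Ou) _.
by rewrite ltW// (lt_trans _ kM)// ltrD2l.
Qed.

Lemma geodesic_exists x y : Omega x -> Omega y ->
  exists2 gamma, qh_geodesic Omega gamma (k x y) & gamma 0 = x /\ gamma (k x y) = y.
Proof.
move=> Ox Oy; set T := k x y; have T0 : 0 <= T by exact: k0.
have [U [UU sU]] := ultraFilterLemma (eventually_filter : ProperFilter \oo).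
have e0 (m : nat) : 0 < m.+1%:R^-1 :> R by rewrite invr_gt0.
have /choice[g gP] := fun m => rough_geodesic Odom OT Ox Oy (e0 m).
have gO m s : 0 <= s <= T -> Omega (g m s) by have [+ _ _ _] := gP m; apply.
have gl m s t : 0 <= s -> s <= t -> t <= T -> k (g m s) (g m t) <= t - s.
  by have [_ _ _] := gP m; apply.
have i1 (m : nat) : m.+1%:R^-1 <= 1 :> R by rewrite invf_le1// ler1n.
have lim s : exists p, 0 <= s <= T -> Omega p /\ (fun m => g m s) @ U --> p.
  have [sT|/negP nsT] := boolP (0 <= s <= T); last by exists 0.
  have /andP[s0 sT'] := sT; have b0 : (0 : R) <= 0 <= T by rewrite lexx T0.
  have [|p [Op _] gp] := ultra_compact_cvg (f := fun m => g m s) UU (@compact_qh_ball x (1 + T) Ox).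
    apply: filterE => m; split; first exact: gO.
    apply: le_trans (kT Ox (gO m 0 b0) (gO m s sT)) _; apply: lerD.
      by have [_ h _ _] := gP m; exact: le_trans h (i1 m).
    by apply: le_trans (gl m 0 s (lexx _) s0 sT') _; rewrite subr0.
  by exists p.
have {lim} /choice[z zP] := lim.
have zO s : 0 <= s <= T -> Omega (z s) by move=> /zP[].
have znear s e : 0 <= s <= T -> 0 < e -> U [set m | k (z s) (g m s) < e].
  move=> sT e0'; have [Oz gz] := zP s sT; have [d d0 dP] := qh_dist_near Oz e0'.
  have : U ((fun m => g m s) @^-1` [set u | eucl_dist (z s) u < d]).
    by apply: gz; apply/nbhs_eucl; exists d.
  by apply: filterS => m /dP[].
have zl s t : 0 <= s -> s <= t -> t <= T -> k (z s) (z t) <= t - s.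
  move=> s0 st tT; apply/ler_addgt0Pr => e e0'; have e2 : 0 < e / 2 by rewrite divr_gt0.
  have sT : 0 <= s <= T by rewrite s0 (le_trans st).
  have tT' : 0 <= t <= T by rewrite tT (le_trans s0).
  have [m [h1 h2]] := filter_ex (filterI (znear s _ sT e2) (znear t _ tT' e2)).
  apply: le_trans (kT (zO s sT) (gO m s sT) (zO t tT')) _.
  apply: le_trans (lerD (ltW h1) (kT (gO m s sT) (gO m t tT') (zO t tT'))) _.
  rewrite (kC (gO m t tT') (zO t tT')).
  apply: le_trans (lerD (lexx _) (lerD (gl m s t s0 st tT) (ltW h2))) _.
  by rewrite addrCA -splitr.
have smallU e : 0 < e -> U [set m | m.+1%:R^-1 < e].
  by move=> e0'; apply: sU; exact: near_infty_natSinv_lt (PosNum e0').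
have b0 : (0 : R) <= 0 <= T by rewrite lexx T0.
have bT : 0 <= T <= T by rewrite T0 lexx.
have z0 : z 0 = x.
  apply/esym/(qh_dist_le0 Odom OT Ox (zO _ b0))/ler_addgt0Pr => e e0'; rewrite add0r.
  have e2 : 0 < e / 2 by rewrite divr_gt0.
  have [m [h1 h2]] := filter_ex (filterI (znear 0 _ b0 e2) (smallU _ e2)).
  apply: le_trans (kT Ox (gO m 0 b0) (zO 0 b0)) _; rewrite (kC (gO m 0 b0) (zO _ b0)).
  by rewrite (splitr e) lerD// ltW//; have [_ h _ _] := gP m; exact: le_lt_trans h h2.
have zT : z T = y.
  apply/(qh_dist_le0 Odom OT (zO _ bT) Oy)/ler_addgt0Pr => e e0'; rewrite add0r.
  have e2 : 0 < e / 2 by rewrite divr_gt0.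
  have [m [h1 h2]] := filter_ex (filterI (znear T _ bT e2) (smallU _ e2)).
  apply: le_trans (kT (zO _ bT) (gO m T bT) Oy) _.
  by rewrite (splitr e) lerD// ltW//; have [_ _ h _] := gP m; exact: le_lt_trans h h2.
(* The limit only inherits upper bounds. Equality follows because the pieces [0, s], [s, t], [t, T]
   must add up to at least T = k x y. *)
have main s t : 0 <= s -> s <= t -> t <= T -> k (z s) (z t) = t - s.
  move=> s0 st tT; apply/eqP; rewrite eq_le zl//=.
  have sT : 0 <= s <= T by rewrite s0 (le_trans st).
  have tT' : 0 <= t <= T by rewrite tT (le_trans s0).
  have h1 := zl 0 s (lexx _) s0 (le_trans st tT).
  have h2 := zl t T (le_trans s0 st) tT (lexx _).
  have := kT Ox (zO s sT) Oy; rewrite -/T => h3; have := kT (zO s sT) (zO t tT') Oy => h4.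
  move: h1 h2; rewrite z0 zT subr0 => h1 h2.
  move: (k x (z s)) (k (z s) y) (k (z s) (z t)) (k (z t) y) h1 h2 h3 h4 => a b c d; lra.
exists z; last by [].
split=> [//|t|s t]; first by rewrite in_itv/=; exact: zO.
rewrite !in_itv/= => sT tT; have /andP[s0 sT'] := sT; have /andP[t0 tT'] := tT.
have [st|/ltW ts] := leP s t; first by rewrite distrC ger0_norm ?subr_ge0// main.
by rewrite (kC (zO s sT) (zO t tT)) main// ger0_norm// subr_ge0.
Qed.

Lemma geodesic_continuous gamma T : qh_geodesic Omega gamma T ->
  {within `[0, T], continuous gamma}.
Proof.
move=> [T0 gO gk]; apply/within_continuous_eucl => t tT e e0.
have tT' : t \in `[0, T] by rewrite in_itv.
have [d d0 dP] := eucl_dist_near (gO t tT') e0.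
exists d => // u uT ut; have uT' : u \in `[0, T] by rewrite in_itv.
by apply: dP; [exact: gO|rewrite gk// distrC].
Qed.

Lemma geodesic_eucl_dist_continuous gamma T p : qh_geodesic Omega gamma T ->
  {within `[0, T], continuous (fun t => eucl_dist (gamma t) p)}.
Proof.
move=> gg; apply/within_continuous_real => t tT e e0.
have /within_continuous_eucl/(_ t tT e e0)[d d0 dP] := geodesic_continuous gg.
by exists d => // u uT ut; apply: le_lt_trans (eucl_dist_sub_le _ _ _) _; exact: dP.
Qed.

Lemma geodesic_sub gamma T s t : qh_geodesic Omega gamma T ->
  0 <= s -> s <= t -> t <= T -> qh_geodesic Omega (fun u => gamma (s + u)) (t - s).
Proof.
move=> [T0 gO gk] s0 st tT.
have sub u : u \in `[0, t - s] -> s + u \in `[0, T].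
  by rewrite !in_itv/= => /andP[u0 ut]; apply/andP; split; lra.
split; first by rewrite subr_ge0.
  by move=> u /sub; exact: gO.
move=> u v /sub us /sub vs; rewrite gk//; congr `|_|; ring.
Qed.

Lemma geodesic_rev gamma T : qh_geodesic Omega gamma T ->
  qh_geodesic Omega (fun u => gamma (T - u)) T.
Proof.
move=> [T0 gO gk].
have sub u : u \in `[0, T] -> T - u \in `[0, T].
  by rewrite !in_itv/= => /andP[u0 ut]; apply/andP; split; lra.
split => //.
  by move=> u /sub; exact: gO.
move=> u v /sub us /sub vs; rewrite gk// -normrN; congr `|_|; ring.
Qed.

End QuasihyperbolicGeometry.

(** * Gromov products under visibility *)

Section Filters.
Context {R : realType} {n : nat}.

Lemma truncn_lt_nat (M : R) i : (Num.truncn M < i)%N -> M < i%:R.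
Proof.
by move=> Mi; apply: lt_le_trans (Num.Theory.truncnS_gt _) _; rewrite ler_nat.
Qed.

Lemma invr_nat_lt (e : R) i : 0 < e -> (Num.truncn e^-1 <= i)%N -> i.+1%:R^-1 < e.
Proof. by move=> e0 ei; rewrite invf_plt ?posrE// truncn_lt_nat. Qed.

Lemma near_infty2P (P : nat -> nat -> Prop) :
  (\forall i \near \oo & j \near \oo, P i j) <->
  exists N, forall i j, (N <= i)%N -> (N <= j)%N -> P i j.
Proof.
split=> [[[A B] /= [[a _ aA] [b _ bB]] H]|[N H]].
  exists (maxn a b) => i j; rewrite !geq_max => /andP[ai _] /andP[_ bj].
  by apply: (H (i, j)); split; [exact: aA|exact: bB].
exists ([set i | (N <= i)%N], [set j | (N <= j)%N]).
  by split; exact: nbhs_infty_ge.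
by move=> [i j] /= [? ?]; exact: H.
Qed.

Lemma ultra_infty : exists U : set_system nat, UltraFilter U /\
  forall N, U [set m | (N <= m)%N].
Proof.
have [U [UU sU]] := ultraFilterLemma (eventually_filter : ProperFilter \oo).
by exists U; split => // N; apply: sU; exact: nbhs_infty_ge.
Qed.

Lemma frequently_cluster (C : set 'rV[R]_n) (u : nat -> 'rV[R]_n) : compact C ->
  (forall N, exists2 j, (N <= j)%N & C (u j)) ->
  exists2 p, C p & forall e, 0 < e -> forall N, exists2 i, (N <= i)%N & eucl_dist p (u i) < e.
Proof.
move=> cC H; have [U [UU geU]] := ultra_infty.
have /choice[j jP] : forall N, exists j, (N <= j)%N /\ C (u j).
  by move=> N; have [j ? ?] := H N; exists j.
have [|p Cp up] := ultra_compact_cvg (f := u \o j) UU cC.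
  by apply: filterE => N; case: (jP N).
exists p => // e e0 N.
have Up : U ((u \o j) @^-1` [set y | eucl_dist p y < e]).
  by apply: up; apply/nbhs_eucl; exists e.
have [m [/= h1 h2]] := filter_ex (filterI Up (geU N)).
by exists (j m) => //; case: (jP m) => mj _; exact: leq_trans mj.
Qed.

End Filters.

Section GromovProduct.
Context {R : realType} {n : nat} (Omega : set 'rV[R]_n).
Hypothesis Odom : domain Omega.
Hypothesis OT : Omega <> setT.
Local Notation delta := (delta Omega).
Local Notation k := (qh_dist Omega).
Implicit Types (w x y z p : 'rV[R]_n) (gamma : R -> 'rV[R]_n) (e r T M : R).

Let kC := qh_distC Odom OT.
Let kxx := qh_distxx Odom OT.
Let kT := qh_dist_triangle Odom OT.

(** Convertible with [gromov_product] for [qh_metric], but on ambient vectors, which avoids the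
    subtype in estimates along curves. *)
Definition qh_product w x y : R := (k x w + k y w - k x y) / 2.
Local Notation gp := qh_product.

Lemma qh_productC w x y : Omega x -> Omega y -> gp w x y = gp w y x.
Proof. by move=> Ox Oy; rewrite /gp (kC Ox Oy) [k x w + _]addrC. Qed.

Lemma qh_product_le_geodesic w gamma T t : Omega w -> qh_geodesic Omega gamma T ->
  0 <= t -> t <= T -> gp w (gamma 0) (gamma T) <= k w (gamma t).
Proof.
move=> Ow [T0 gO gk] t0 tT.
have i0 : (0 : R) \in `[0, T] by rewrite in_itv/= lexx T0.
have iT : T \in `[0, T] by rewrite in_itv/= T0 lexx.
have it : t \in `[0, T] by rewrite in_itv/= t0.
have h1 := kT (gO _ i0) (gO _ it) Ow; have h2 := kT (gO _ iT) (gO _ it) Ow.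
rewrite /gp gk// (kC Ow (gO _ it)).
rewrite gk// sub0r normrN ger0_norm// in h1; rewrite gk// ger0_norm ?subr_ge0// in h2.
rewrite sub0r normrN ger0_norm//.
move: (k (gamma 0) w) (k (gamma t) w) (k (gamma T) w) h1 h2 => a b c h1 h2.
by rewrite ler_pdivrMr//; lra.
Qed.

Lemma qh_product_base w w' x y : Omega w -> Omega w' -> Omega x -> Omega y ->
  gp w x y - k w w' <= gp w' x y.
Proof.
move=> Ow Ow' Ox Oy; have := kT Ox Ow' Ow; have := kT Oy Ow' Ow.
rewrite /gp (kC Ow Ow').
move: (k x w) (k w' w) (k x w') (k y w) (k y w') (k x y) => a b c d f g h1 h2.
by rewrite lerBlDr; lra.
Qed.

Lemma qh_product_diag w x : Omega x -> gp w x x = k x w.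
Proof. by move=> Ox; rewrite /gp kxx// subr0 mulrDl -splitr. Qed.

Lemma geodesic_crosses_sphere gamma T p r : qh_geodesic Omega gamma T ->
  eucl_dist p (gamma 0) < r -> r <= eucl_dist p (gamma T) ->
  exists2 t, 0 <= t <= T & eucl_dist p (gamma t) = r.
Proof.
move=> gg h0 hT; have [T0 _ _] := gg.
have fc := geodesic_eucl_dist_continuous Odom OT (p := p) gg.
have [|t] := @IVT _ _ 0 T r T0 fc.
  by rewrite !(eucl_distC _ p) ge_min (ltW h0)/= le_max hT orbT.
by rewrite in_itv/= => tT; rewrite eucl_distC => tr; exists t.
Qed.

Lemma visibility_product_bounded w p r : QH_visibility_domain Omega -> Omega w ->
  eboundary Omega p -> 0 < r -> exists d M : R, 0 < d /\
  forall x y, Omega x -> Omega y -> eucl_dist p x < d -> r <= eucl_dist p y -> gp w x y <= M.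
Proof.
move=> [_ vis] Ow ep r0; apply: contrapT => H.
have {H} /choice[g gP] : forall m : nat, exists gT : (R -> 'rV[R]_n) * R,
    [/\ qh_geodesic Omega gT.1 gT.2, eucl_dist p (gT.1 0) < m.+1%:R^-1,
        eucl_dist p (gT.1 gT.2) = r &
        forall t, 0 <= t <= gT.2 -> m%:R < k w (gT.1 t)].
  move=> m; apply: contrapT => Hm; apply: H.
  exists (Num.min r m.+1%:R^-1), m%:R; split; first by rewrite lt_min r0 invr_gt0 ltr0Sn.
  move=> x y Ox Oy; rewrite lt_min => /andP[xr xm] yr.
  rewrite leNgt; apply/negP => mgp; apply: Hm.
  have [g gg [g0 gT]] := geodesic_exists Odom OT Ox Oy.
  (* Any crossing of the sphere will do: the part up to it is a geodesic that stays outside the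
     k-ball of radius m, and its endpoint lies in a fixed compact set. *)
  have [|//|t /andP[t0 tT] tr] := @geodesic_crosses_sphere g (k x y) p r gg.
  - by rewrite g0.
  - by rewrite gT.
  exists (g, t) => /=; split => //; last 2 first.
  - by rewrite g0.
  - move=> s /andP[s0 st]; apply: lt_le_trans mgp _.
    rewrite -{1}g0 -{1}gT; apply: qh_product_le_geodesic => //.
    exact: le_trans tT.
  have := geodesic_sub gg (lexx _) t0 tT; rewrite subr0.
  by under eq_fun do rewrite add0r.
have [U [UU geU]] := ultra_infty.
pose z m := (g m).1 (g m).2.
have zO m : Omega (z m).
  by have [[T0 gO _] _ _ _] := gP m; apply: gO; rewrite in_itv/= T0 lexx.
have [|q pq zq] := ultra_compact_cvg (f := z) UU (@compact_eucl_ball _ _ p r).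
  by apply: filterE => m /=; rewrite eucl_distC; have [_ _ -> _] := gP m.
have zqn e : 0 < e -> U [set m | eucl_dist q (z m) < e].
  by move=> e0; apply: (zq [set u | eucl_dist q u < e]); apply/nbhs_eucl; exists e.
have cq : closure Omega q.
  move=> B /nbhs_eucl[e e0 eB]; have [m mq] := filter_ex (zqn e e0).
  by exists (z m); split; [exact: zO|exact: eB].
have pqr : r <= eucl_dist p q.
  apply/ler_addgt0Pr => e e0; have [m mq] := filter_ex (zqn e e0).
  have [_ _ <- _] := gP m; apply: le_trans (eucl_dist_triangle q _ _) _.
  by rewrite lerD2l ltW.
(* Around a point of Omega the distance k to w is bounded, whereas the points z m leave every
   k-ball. *)
have nOq : ~ Omega q.
  move=> Oq; have [d d0 dP] := qh_dist_near Odom OT Oq ltr01.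
  have [m [mq mM]] := filter_ex (filterI (zqn d d0) (geU (Num.truncn (k w q + 1)).+1)).
  have [_ qz] := dP _ mq; have [[T0 _ _] _ _ gm] := gP m.
  have /gm : 0 <= (g m).2 <= (g m).2 by rewrite T0 lexx.
  rewrite -/(z m) ltNge => /negP; apply.
  apply: le_trans (kT Ow Oq (zO m)) _.
  apply: le_trans (lerD (lexx _) (ltW qz)) _.
  exact/ltW/truncn_lt_nat.
have [|Up [Uq [K [[nUp nUq _] [cK KO HK]]]]] := vis p q ep (eboundaryP cq nOq).
  by move=> pq'; move: pqr; rewrite pq' eucl_distxx leNgt r0.
have [M HM] := qh_dist_bounded_compact Odom OT Ow cK KO.
have /nbhs_eucl[e e0 eU] := nUp; have /nbhs_eucl[e' e'0 e'U] := nUq.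
have smallU : U [set m | m.+1%:R^-1 < e].
  by apply: filterS (geU (Num.truncn e^-1)) => m /=; exact: invr_nat_lt.
have [m [[mq mM] me]] :=
  filter_ex (filterI (filterI (zqn e' e'0) (geU (Num.truncn M).+1)) smallU).
have [gg g0 gT gm] := gP m.
have [||_ [[t tT <-] Kt]] := HK _ _ gg.
- by apply: eU; exact: lt_trans me.
- exact: e'U.
have := HM _ Kt; rewrite leNgt => /negP; apply; apply: le_lt_trans (gm t _).
  exact/ltW/truncn_lt_nat.
by move: tT; rewrite /= in_itv.
Qed.

Lemma qh_dist_escape_eboundary w p (u : nat -> 'rV[R]_n) : Omega w ->
  (forall i, Omega (u i)) ->
  (forall M, exists N, forall i, (N <= i)%N -> M <= k w (u i)) ->
  (forall e, 0 < e -> forall N, exists2 i, (N <= i)%N & eucl_dist p (u i) < e) ->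
  eboundary Omega p.
Proof.
move=> Ow uO ku pu; apply: eboundaryP.
  move=> B /nbhs_eucl[e e0 eB]; have [i _ ip] := pu e e0 0.
  by exists (u i); split => //; exact: eB.
move=> Op; have [d d0 dP] := qh_dist_near Odom OT Op ltr01.
have [N NP] := ku (k w p + 1); have [i Ni ip] := pu d d0 N.
have [_ pi] := dP _ ip; have := NP i Ni; rewrite leNgt => /negP; apply.
by apply: le_lt_trans (kT Ow Op (uO i)) _; rewrite ltrD2l.
Qed.

(** A diagonal argument in the manner of Arzela-Ascoli. Along an ultrafilter, the points at integer
    distance l on geodesics from w to x m have a limit q l. The index phi j is chosen so that its
    geodesic passes within 1 of q l for all l <= j. Two such geodesics with indices at least l are
    within 2 of each other at distance l, so the product of their endpoints is at least l - 1. *)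
Lemma escape_subsequence w (x : nat -> 'rV[R]_n) : Omega w -> (forall m, Omega (x m)) ->
  (forall M, exists N, forall i, (N <= i)%N -> M <= k w (x i)) ->
  exists2 phi : nat -> nat, forall j, (j <= phi j)%N &
  forall M, exists N, forall i j, (N <= i)%N -> (N <= j)%N -> M <= gp w (x (phi i)) (x (phi j)).
Proof.
move=> Ow xO xinf; have [U [UU geU]] := ultra_infty.
have /choice[g gP] : forall m, exists g, qh_geodesic Omega g (k w (x m)) /\
    (g 0 = w /\ g (k w (x m)) = x m).
  by move=> m; have [g gg g0] := geodesic_exists Odom OT Ow (xO m); exists g.
have U_le l : U [set m | l <= k w (x m)].
  by have [N NP] := xinf l; apply: filterS (geU N) => m /= /NP.
have gd m (l : R) : 0 <= l -> l <= k w (x m) ->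
    [/\ Omega (g m l), k w (g m l) = l & k (g m l) (x m) = k w (x m) - l].
  move=> l0 lm; have [[T0 gO gk] [g0 gT]] := gP m.
  have il : l \in `[0, k w (x m)] by rewrite in_itv/= l0.
  have i0 : 0 \in `[0, k w (x m)] by rewrite in_itv/= lexx T0.
  have iT : k w (x m) \in `[0, k w (x m)] by rewrite in_itv/= T0 lexx.
  split; first exact: gO.
    by have := gk _ _ i0 il; rewrite g0 sub0r normrN ger0_norm.
  by have := gk _ _ il iT; rewrite gT distrC ger0_norm ?subr_ge0.
have /choice[q qP] : forall l : nat, exists q, Omega q /\
    U [set m | l%:R <= k w (x m) /\ k q (g m l%:R) < 1].
  move=> l; have [|q [Oq _] gq] :=
    ultra_compact_cvg (f := fun m => g m l%:R) UU (@compact_qh_ball _ _ _ Odom OT w l%:R Ow).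
    apply: filterS (U_le l%:R) => m /= lm.
    by have [? -> _] := gd m l%:R (ler0n _ _) lm.
  exists q; split => //; have [d d0 dP] := qh_dist_near Odom OT Oq ltr01.
  have : U ((fun m => g m l%:R) @^-1` [set u | eucl_dist q u < d]).
    by apply: gq; apply/nbhs_eucl; exists d.
  by move=> /filterI/(_ (U_le l%:R)); apply: filterS => m [/dP[_ ?] ?].
pose A l := [set m | l%:R <= k w (x m) /\ k (q l) (g m l%:R) < 1].
have UA j : U [set m | forall l, (l <= j)%N -> A l m].
  elim: j => [|j IH].
    by apply: filterS (qP 0).2 => m Am l; rewrite leqn0 => /eqP ->.
  apply: filterS (filterI IH (qP j.+1).2) => m [h1 h2] l.
  by rewrite leq_eqVlt => /predU1P[->//|]; rewrite ltnS; exact: h1.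
have /choice[phi phiP] : forall j, exists m, (j <= m)%N /\ forall l, (l <= j)%N -> A l m.
  by move=> j; have [m [h1 h2]] := filter_ex (filterI (geU j) (UA j)); exists m.
exists phi => [j|M]; first by case: (phiP j).
pose l := (Num.truncn (M + 1)).+1; exists l => i j li lj.
have [_ /(_ l li)[h1 h2]] := phiP i; have [_ /(_ l lj)[h3 h4]] := phiP j.
set a := phi i in h1 h2 *; set b := phi j in h3 h4 *.
have [Oga _ ga] := gd a l%:R (ler0n _ _) h1; have [Ogb _ gb] := gd b l%:R (ler0n _ _) h3.
have [Oq _] := qP l.
have lM : M + 1 <= l%:R by exact/ltW/truncn_lt_nat.
have t1 := kT (xO a) Oga (xO b); have t2 := kT Oga Ogb (xO b); have t3 := kT Oga Oq Ogb.
move: t1 t2 t3; rewrite (kC (xO a) Oga) (kC Oga Oq) ga gb /gp (kC (xO a) Ow) (kC (xO b) Ow).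
by move=> t1 t2 t3; rewrite ler_pdivlMr//; lra.
Qed.

End GromovProduct.

(** * The extension of the identity map *)

Section GromovBoundary.
Context {R : realType} {n : nat} (Omega : set 'rV[R]_n).
Hypothesis Odom : domain Omega.
Hypothesis OT : Omega <> setT.
Local Notation k := (qh_dist Omega).
Local Notation gp := (qh_product Omega).
Local Notation dk := (@qh_metric R n Omega).
Local Notation opc := (one_point_compactification 'rV[R]_n).
Implicit Types (w x y z : Omega) (p : 'rV[R]_n) (u v : nat -> Omega) (e r M : R).

Let kC := qh_distC Odom OT.
Let kT := qh_dist_triangle Odom OT.
Let vO x : Omega (val x) := set_valP x.

Definition in_domain (z : 'rV[R]_n) (Oz : Omega z) : Omega := exist _ z (mem_set Oz).

Lemma gromov_equivP u v : gromov_equiv dk u v <-> forall w M, exists N, forall i j,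
  (N <= i)%N -> (N <= j)%N -> M <= gp (val w) (val (u i)) (val (v j)).
Proof.
by split=> H w M; have := H w M; [move=> /near_infty2P|move=> h; apply/near_infty2P].
Qed.

Lemma gromov_equiv_base u v (w0 : Omega) :
  (forall M, exists N, forall i j, (N <= i)%N -> (N <= j)%N ->
     M <= gp (val w0) (val (u i)) (val (v j))) -> gromov_equiv dk u v.
Proof.
move=> H; apply/gromov_equivP => w M; have [N NP] := H (M + k (val w0) (val w)).
exists N => i j Ni Nj.
apply: le_trans (qh_product_base Odom OT (vO w0) (vO w) (vO _) (vO _)).
by rewrite lerBrDr; exact: NP.
Qed.

Lemma gromov_equivC u v : gromov_equiv dk u v -> gromov_equiv dk v u.
Proof.
move/gromov_equivP => H; apply/gromov_equivP => w M; have [N NP] := H w M.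
by exists N => i j Ni Nj; rewrite qh_productC//; exact: NP.
Qed.

Lemma gromov_sequence_escape u w : gromov_sequence dk u ->
  forall M, exists N, forall i, (N <= i)%N -> M <= k (val w) (val (u i)).
Proof.
move=> /gromov_equivP H M; have [N NP] := H w M; exists N => i Ni.
by have := NP i i Ni Ni; rewrite qh_product_diag// kC.
Qed.

Lemma cvg_gromov_boundary (xi : gromov_boundary dk) u : sval xi u ->
  forall B, nbhs (GBoundary xi) B -> exists N, forall j, (N <= j)%N -> B (GInterior _ (u j)).
Proof.
case: xi => C [u0 gu0 CE] /= Cu B; rewrite nbhsE => -[W [oW Wxi] WB].
have [_ /(_ _ Wxi)Wr] := oW; have [r rP] := Wr (u 0%N).
have [gu _] : gromov_sequence dk u /\ gromov_equiv dk u0 u by move: Cu; rewrite CE.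
have /gromov_equivP/(_ (u 0%N) r)[N NP] := gu.
exists N => j Nj; apply/WB/rP; exists u => //.
by exists N => // i /= Ni; exact: NP.
Qed.

Lemma escape_gromov_boundary u w :
  (forall M, exists N, forall i, (N <= i)%N -> M <= k (val w) (val (u i))) ->
  exists2 phi : nat -> nat, forall j, (j <= phi j)%N &
  exists xi : gromov_boundary dk, sval xi (u \o phi).
Proof.
move=> H; have [phi phij phiP] := escape_subsequence Odom OT (vO w) (fun m => vO (u m)) H.
exists phi => //; have gu : gromov_sequence dk (u \o phi) by exact: gromov_equiv_base phiP.
pose C := [set v | gromov_sequence dk v /\ gromov_equiv dk (u \o phi) v].
have HC : exists2 u', gromov_sequence dk u' &
    C = [set v | gromov_sequence dk v /\ gromov_equiv dk u' v] by exists (u \o phi).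
by exists (exist _ C HC).
Qed.

Lemma gromov_boundary_rep (xi : gromov_boundary dk) : exists u, [/\ sval xi u,
  gromov_sequence dk u & forall v, sval xi v -> gromov_sequence dk v /\ gromov_equiv dk u v].
Proof. by case: xi => C [u gu /= ->]; exists u; split => // v []. Qed.

(** A finite limit is required to be a boundary point, so that the visibility bound applies at
    it. *)
Definition cvg_infty u (P : opc) := match P with
  | Some p => eboundary Omega p /\
     forall e, 0 < e -> exists N, forall j, (N <= j)%N -> eucl_dist p (val (u j)) < e
  | None => forall M, exists N, forall j, (N <= j)%N -> M < eucl_dist 0 (val (u j))
  end.

Section visibility.
Hypothesis vis : QH_visibility_domain Omega.

Let vis_bound w p r : eboundary Omega p -> 0 < r -> exists d M : R, 0 < d /\
  forall x y, eucl_dist p (val x) < d -> r <= eucl_dist p (val y) ->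
  gp (val w) (val x) (val y) <= M.
Proof.
move=> ep r0.
have [d [M [d0 H]]] := visibility_product_bounded Odom OT vis (vO w) ep r0.
by exists d, M; split => // x y xd yr; exact: H.
Qed.

(** It is enough that u comes close to p infinitely often: with u i near p, a large product with v j
    excludes that v j is at distance e or more from p. *)
Lemma visibility_cvg u v p : gromov_equiv dk u v -> eboundary Omega p ->
  (forall e, 0 < e -> forall N, exists2 i, (N <= i)%N & eucl_dist p (val (u i)) < e) ->
  cvg_infty v (Some p).
Proof.
move=> /gromov_equivP uv ep up; split => // e e0.
have [d [M [d0 H]]] := vis_bound (u 0%N) ep e0.
have [N NP] := uv (u 0%N) (M + 1); have [i Ni ud] := up d d0 N.
exists N => j Nj; rewrite ltNge; apply/negP => /(H _ _ ud).
by rewrite leNgt => /negP; apply; apply: lt_le_trans (NP i j Ni Nj); rewrite ltrDl.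
Qed.

(** If the representative u0 clusters at a boundary point, the whole class converges to it.
    Otherwise every u in the class tends to infinity: a bounded subsequence of u would cluster at a
    boundary point, to which u0 would then converge. *)
Lemma gromov_boundary_cvg (xi : gromov_boundary dk) : exists P, forall u,
  sval xi u -> cvg_infty u P.
Proof.
have [u0 [_ gu0 xiP]] := gromov_boundary_rep xi.
have [[p [ep u0p]]|nop] := pselect (exists p, eboundary Omega p /\
    forall e, 0 < e -> forall N, exists2 i, (N <= i)%N & eucl_dist p (val (u0 i)) < e).
  by exists (Some p) => u /xiP[_ u0u]; exact: visibility_cvg u0u ep u0p.
exists None => u /xiP[gu u0u] M; apply: contrapT => HM; apply: nop.
have [||p _ up] := @frequently_cluster _ _ [set y | eucl_dist y 0 <= M] (val \o u).
- exact: compact_eucl_ball.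
- move=> N; apply: contrapT => HN; apply: HM; exists N => j Nj.
  rewrite ltNge; apply/negP => uj; apply: HN; exists j => //=.
  by rewrite eucl_distC.
have ep : eboundary Omega p.
  apply: (qh_dist_escape_eboundary Odom OT (vO (u 0%N)) (fun i => vO (u i)) _ up).
  exact: gromov_sequence_escape gu.
exists p; split => // e e0 N.
have [_ /(_ e e0)[N' N'P]] := visibility_cvg (gromov_equivC u0u) ep up.
by exists (maxn N N'); [exact: leq_maxl|apply: N'P; exact: leq_maxr].
Qed.

Definition boundary_value (xi : gromov_boundary dk) : opc :=
  projT1 (cid (gromov_boundary_cvg xi)).

Lemma boundary_valueP xi u : sval xi u -> cvg_infty u (boundary_value xi).
Proof. by rewrite /boundary_value; case: cid => /= P; apply. Qed.

Definition visibility_extension (z : gromov_compactification dk) : opc :=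
  match z with GInterior x => Some (val x) | GBoundary xi => boundary_value xi end.

(** The counterpart at infinity of the visibility bound, by contradiction: bounded points y with
    products at least m for every m leave all k-balls and cluster at a boundary point p. The
    sequences u tend to infinity, hence away from p, and the bound at p limits the products. *)
Lemma visibility_infty_bound w (xi : gromov_boundary dk) M :
  boundary_value xi = None -> exists r, forall u y, sval xi u ->
  (exists N, forall i, (N <= i)%N -> r <= gp (val w) (val (u i)) (val y)) ->
  M < eucl_dist 0 (val y).
Proof.
move=> xiN; apply: contrapT => H.
have /choice[uy uyP] : forall m : nat, exists uy : (nat -> Omega) * Omega,
    [/\ sval xi uy.1, eucl_dist 0 (val uy.2) <= M &
        exists N, forall i, (N <= i)%N -> m%:R <= gp (val w) (val (uy.1 i)) (val uy.2)].
  move=> m; apply: contrapT => Hm; apply: H; exists m%:R => u y xiu uN.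
  rewrite ltNge; apply/negP => yM; apply: Hm.
  by exists (u, y).
have uinf m := boundary_valueP (let: And3 h _ _ := uyP m in h).
have yinf L : exists N, forall i, (N <= i)%N -> L <= k (val w) (val (uy i).2).
  exists (Num.truncn L).+1 => i Ni; have [_ _ [N NP]] := uyP i.
  apply: (@le_trans _ _ i%:R); first exact: ltW (truncn_lt_nat Ni).
  apply: le_trans (NP N (leqnn _)) _.
  have := kT (vO ((uy i).1 N)) (vO (uy i).2) (vO w).
  rewrite /qh_product (kC (vO (uy i).2) (vO w)).
  move: (k (val ((uy i).1 N)) (val w)) (k (val ((uy i).1 N)) (val (uy i).2)).
  move: (k (val w) (val (uy i).2)) => a b c h; rewrite ler_pdivrMr//; lra.
have [||p _ yp] := @frequently_cluster _ _ [set y | eucl_dist y 0 <= M] (fun i => val (uy i).2).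
- exact: compact_eucl_ball.
- by move=> N; exists N => //=; rewrite eucl_distC; case: (uyP N).
have ep := qh_dist_escape_eboundary Odom OT (vO w) (fun i => vO (uy i).2) yinf yp.
have [d [L [d0 HL]]] := vis_bound w ep ltr01.
have [m mL yd] := yp d d0 (Num.truncn L).+1.
have [xiu _ [N NP]] := uyP m.
have := boundary_valueP xiu; rewrite xiN => /(_ (eucl_dist p 0 + 1))[N' N'P].
pose i := maxn N N'.
have up : 1 <= eucl_dist p (val ((uy m).1 i)).
  have := N'P i (leq_maxr _ _); have := eucl_dist_triangle p 0 (val ((uy m).1 i)).
  by rewrite (eucl_distC 0 p); lra.
have := HL _ _ yd up; rewrite qh_productC// leNgt => /negP; apply.
apply: lt_le_trans (NP i (leq_maxl _ _)).
exact: truncn_lt_nat.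
Qed.

Lemma near_filter_nat (P : nat -> Prop) : (\forall i \near \oo, P i) ->
  exists N, forall i, (N <= i)%N -> P i.
Proof. by move=> [N _ NP]; exists N. Qed.

Lemma visibility_extension_continuous : continuous visibility_extension.
Proof.
apply/continuousP => A oA; suff : gromov_open (visibility_extension @^-1` A) by [].
have nA P : A P -> nbhs P A by move=> AP; apply: open_nbhs_nbhs.
split=> [x /nA Ax|xi /nA Axi w].
  have /nbhs_eucl[e e0 eA] : nbhs (val x) (fun z : 'rV[R]_n => A (Some z)) by exact: Ax.
  have [d d0 dP] := eucl_dist_near Odom OT (vO x) e0.
  by exists d => // y xy; apply: eA; apply: dP.
move: Axi; rewrite /visibility_extension.
case xiE : (boundary_value xi) => [p|] Axi.
  have /nbhs_eucl[e e0 eA] : nbhs p (fun z : 'rV[R]_n => A (Some z)) by exact: Axi.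
  have ep : eboundary Omega p.
    have [u [xiu _ _]] := gromov_boundary_rep xi.
    by have := boundary_valueP xiu; rewrite xiE; case.
  have e20 : 0 < e / 2 by rewrite divr_gt0.
  have [d [M [d0 H]]] := vis_bound w ep e20.
  have key u y i : eucl_dist p (val (u i)) < d ->
      M + 1 <= gp (val w) (val (u i)) (val y) -> eucl_dist p (val y) < e / 2.
    move=> ud uy; rewrite ltNge; apply/negP => /(H _ _ ud).
    by rewrite leNgt => /negP; apply; apply: lt_le_trans uy; rewrite ltrDl.
  exists (M + 1) => -[y|eta] /=.
    move=> [u xiu /near_filter_nat[N NP]]; apply: eA.
    have := boundary_valueP xiu; rewrite xiE => -[_ /(_ d d0)[N' N'P]].
    have := key u y (maxn N N') (N'P _ (leq_maxr _ _)) (NP _ (leq_maxl _ _)).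
    by move=> h; apply: lt_trans h _; lra.
  (* The representative v of eta ends up within e/2 of p. So its limit is not infinity, and a finite
     limit q is within e of p. *)
  move=> [u [v [xiu etav /near_infty2P[N NP]]]].
  have := boundary_valueP xiu; rewrite xiE => -[_ /(_ d d0)[N' N'P]].
  have vp j : (N <= j)%N -> eucl_dist p (val (v j)) < e / 2.
    move=> Nj; apply: (key u (v j) (maxn N N')); first exact/N'P/leq_maxr.
    exact: NP (leq_maxl _ _) Nj.
  have := boundary_valueP etav; case: (boundary_value eta) => [q|].
    move=> [_ /(_ _ e20)[N'' N''P]]; apply: eA.
    have h1 := vp _ (leq_maxl N N''); have h2 := N''P _ (leq_maxr N N'').
    apply: le_lt_trans (eucl_dist_triangle (val (v (maxn N N''))) _ _) _.
    by rewrite (eucl_distC _ q) (splitr e) ltrD.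
  move=> /(_ (eucl_dist 0 p + e / 2))[N'' N''P].
  have h1 := vp _ (leq_maxl N N''); have h2 := N''P _ (leq_maxr N N'').
  by have := eucl_dist_triangle p 0 (val (v (maxn N N''))); lra.
have [C [cC clC] CA] : filter_from (compact `&` closed)
    (fun U => (Some @` (~` U)) `|` [set None]) A by exact: Axi.
have [M MC] : exists M, forall z : 'rV[R]_n, C z -> eucl_dist 0 z <= M.
  have [M [Mr HM]] := compact_bounded cC.
  exists (n.+1%:R * (M + 1)) => y Cy; rewrite eucl_distC.
  apply: le_trans (eucl_dist_le_norm _ _) _; rewrite subr0 ler_wpM2l//.
  by apply: HM Cy; rewrite ltrDl.
(* The margin 1 serves the boundary points eta, whose finite value q is within 1 of some v j. *)
have [r rP] := visibility_infty_bound w (M + 1) xiE.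
exists r => -[y|eta] /=.
  move=> [u xiu /near_filter_nat uN]; apply: CA; left; exists (val y) => //= /MC.
  by have := rP u y xiu uN; lra.
move=> [u [v [xiu etav /near_infty2P[N NP]]]].
have vM j : (N <= j)%N -> M + 1 < eucl_dist 0 (val (v j)).
  by move=> Nj; apply: (rP u) => //; exists N => i Ni; exact: NP.
have := boundary_valueP etav; case: (boundary_value eta) => [q|].
  move=> [_ /(_ _ ltr01)[N' N'P]]; apply: CA; left; exists q => //= /MC qM.
  have h1 := vM _ (leq_maxl N N'); have h2 := N'P _ (leq_maxr N N').
  by have := eucl_dist_triangle q 0 (val (v (maxn N N'))); lra.
by move=> _; apply: CA; right.
Qed.

Lemma visibility_extension_range : range visibility_extension = closure_infty Omega.
Proof.
apply/seteqP; split.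
  move=> _ [[x|xi] _ <-] /=; first by apply: subset_closure; exists (val x).
  have [u [xiu _ _]] := gromov_boundary_rep xi; have := boundary_valueP xiu.
  case: (boundary_value xi) => [p [_ up] B Bp|uinf B Binf].
    have /nbhs_eucl[e e0 eB] : nbhs p (fun z : 'rV[R]_n => B (Some z)) by exact: Bp.
    have [N NP] := up e e0.
    by exists (Some (val (u N))); split; [exists (val (u N))|exact/eB/NP].
  have [C [cC clC] CB] : filter_from (compact `&` closed)
    (fun U => (Some @` (~` U)) `|` [set None]) B by exact: Binf.
  have [M [Mr HM]] := compact_bounded cC.
  have [N NP] := uinf (n.+1%:R * (M + 1)).
  exists (Some (val (u N))); split; first by exists (val (u N)).
  apply: CB; left; exists (val (u N)) => //= /HM h.
  have := NP N (leqnn _); rewrite ltNge => /negP; apply; rewrite eucl_distC.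
  apply: le_trans (eucl_dist_le_norm _ _) _; rewrite subr0 ler_wpM2l//.
  by apply: h; rewrite ltrDl.
have [_ _ [w0 Ow0]] := Odom.
pose w := in_domain Ow0.
(* A sequence that tends to P and leaves every k-ball has a subsequence representing a Gromov
   boundary point; the value there is P because limits are unique. *)
have build (u : nat -> Omega) P : cvg_infty u P ->
    (forall M, exists N, forall i, (N <= i)%N -> M <= k (val w) (val (u i))) ->
    range visibility_extension P.
  move=> uP /escape_gromov_boundary[phi phij [xi xiu]].
  exists (GBoundary xi) => //=; have := boundary_valueP xiu.
  case: P uP => [p [ep up]|uinf]; case: (boundary_value xi) => [q|] //.
  - move=> [eq uq]; congr Some; apply: eucl_dist_le0.
    apply/ler_addgt0Pr => e e0; rewrite add0r; have e20 : 0 < e / 2 by rewrite divr_gt0.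
    have [N NP] := up _ e20; have [N' N'P] := uq _ e20; pose j := maxn N N'.
    have h1 := NP (phi j) (leq_trans (leq_maxl _ _) (phij _)).
    have h2 := N'P j (leq_maxr _ _).
    have := eucl_dist_triangle (val (u (phi j))) q p.
    by rewrite (eucl_distC (val (u (phi j))) p); move: h2 => /=; lra.
  - move=> uq; exfalso; have [N NP] := up _ ltr01.
    have [N' N'P] := uq (eucl_dist 0 p + 1); pose j := maxn N N'.
    have h1 := NP (phi j) (leq_trans (leq_maxl _ _) (phij _)).
    have h2 := N'P j (leq_maxr _ _).
    by have := eucl_dist_triangle p 0 (val (u (phi j))); move: h2 => /=; lra.
  - move=> [eq uq]; exfalso; have [N NP] := uq _ ltr01.
    have [N' N'P] := uinf (eucl_dist 0 q + 1); pose j := maxn N N'.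
    have h1 := N'P (phi j) (leq_trans (leq_maxr _ _) (phij _)).
    have h2 := NP j (leq_maxl _ _).
    by have := eucl_dist_triangle q 0 (val (u (phi j))); move: h2 => /=; lra.
move=> [p|] cP.
  have [Op|nOp] := pselect (Omega p); first by exists (GInterior _ (in_domain Op)).
  have cp : closure Omega p.
    move=> B /one_point_compactification_some_nbhs /cP[_ [[y Oy <-] [y' By' [E]]]].
    by exists y; split => //; rewrite -E.
  have ep := eboundaryP cp nOp.
  have /choice[u up] : forall m : nat, exists x : Omega, eucl_dist p (val x) < m.+1%:R^-1.
    move=> m; have [|y [Oy yp]] := cp [set y | eucl_dist p y < m.+1%:R^-1].
      by apply/nbhs_eucl; exists m.+1%:R^-1; rewrite ?invr_gt0 ?ltr0Sn.
    by exists (in_domain Oy).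
  have ucvg e : 0 < e -> exists N, forall j, (N <= j)%N -> eucl_dist p (val (u j)) < e.
    by move=> e0; exists (Num.truncn e^-1) => j Nj; exact/(lt_trans (up j))/invr_nat_lt.
  (* On a k-ball [delta] is at least some c > 0, whereas delta (u i) <= |u i - p| tends to 0. For
     the point at infinity the Euclidean bound on k-balls plays this part. *)
  apply: (build u) => // M; have [c [L [c0 cP']]] := qh_ball_bounds Odom OT M Ow0.
  have [N NP] := ucvg c c0; exists N => i Ni; rewrite leNgt; apply/negP => /ltW kM.
  have [h _] := cP' _ (vO (u i)) kM; have := NP i Ni; rewrite ltNge => /negP; apply.
  by apply: le_trans h _; rewrite eucl_distC (delta_le Odom OT).
have /choice[u up] : forall m : nat, exists x : Omega, m%:R < eucl_dist 0 (val x).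
  move=> m; pose B := [set y : 'rV[R]_n | eucl_dist y 0 <= m%:R].
  have [|_ [[y Oy <-] [[y' nBy' [E]]|//]]] := cP ((Some @` (~` B)) `|` [set None]).
    by exists B => //; split; [exact: compact_eucl_ball|exact: closed_eucl_ball].
  exists (in_domain Oy) => /=; rewrite -E ltNge eucl_distC; exact/negP.
have uinf M : exists N, forall j, (N <= j)%N -> M < eucl_dist 0 (val (u j)).
  exists (Num.truncn M).+1 => j Nj; apply: lt_trans (up j).
  exact: truncn_lt_nat.
apply: (build u) => // M; have [c [L [c0 cP']]] := qh_ball_bounds Odom OT M Ow0.
have [N NP] := uinf (eucl_dist 0 w0 + L); exists N => i Ni; rewrite leNgt; apply/negP => /ltW kM.
have [_ h] := cP' _ (vO (u i)) kM; have := NP i Ni; rewrite ltNge => /negP; apply.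
by apply: le_trans (eucl_dist_triangle w0 _ _) _; rewrite lerD2l.
Qed.

End visibility.
End GromovBoundary.

(** * From the extension to visibility *)

Section ExtensionVisibility.
Context {R : realType} {n : nat} (Omega : set 'rV[R]_n).
Hypothesis Odom : domain Omega.
Hypothesis OT : Omega <> setT.
Local Notation k := (qh_dist Omega).
Local Notation gp := (qh_product Omega).
Local Notation dk := (@qh_metric R n Omega).
Local Notation opc := (one_point_compactification 'rV[R]_n).
Implicit Types (p q : 'rV[R]_n) (u v : nat -> Omega) (e r M : R).

Let kC := qh_distC Odom OT.
Let kT := qh_dist_triangle Odom OT.
Let vO (x : Omega) : Omega (val x) := set_valP x.

Hypothesis hyp : gromov_hyperbolic dk.

Let hyp_product : exists D, 0 <= D /\ forall w x y z : 'rV[R]_n,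
  Omega w -> Omega x -> Omega y -> Omega z ->
  Num.min (gp w x y) (gp w y z) - D <= gp w x z.
Proof.
have [D H] := hyp; exists (Num.max 0 D); split; first by rewrite le_max lexx.
move=> w x y z Ow Ox Oy Oz.
apply: le_trans (H (in_domain Ow) (in_domain Ox) (in_domain Oy) (in_domain Oz)).
by rewrite lerD2l lerN2 le_max lexx orbT.
Qed.

(* At the point [z] of the geodesic where [k x z] is the Gromov product of [w]
   and [y] based at [x], the products of [x, z] and of [z, y] based at [w] agree. *)
Lemma geodesic_near_product : exists2 D, 0 <= D & forall w gamma T,
  Omega w -> qh_geodesic Omega gamma T -> exists2 t, 0 <= t <= T &
  k w (gamma t) <= gp w (gamma 0) (gamma T) + D.
Proof.
have [D [D0 H]] := hyp_product; exists (2 * D); first by rewrite mulr_ge0.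
move=> w g T Ow [T0 gO gk].
have i0 : (0 : R) \in `[0, T] by rewrite in_itv/= lexx T0.
have iT : T \in `[0, T] by rewrite in_itv/= T0 lexx.
have k0T : k (g 0) (g T) = T by rewrite gk// sub0r normrN ger0_norm.
have t1 := kT (gO _ iT) (gO _ i0) Ow; have t2 := kT (gO _ i0) (gO _ iT) Ow.
have t3 := kT (gO _ i0) Ow (gO _ iT).
rewrite (kC (gO _ iT) (gO _ i0)) k0T in t1.
rewrite k0T in t2 t3; rewrite (kC Ow (gO _ iT)) in t3.
pose t := (k (g 0) w + T - k (g T) w) / 2.
have t0 : 0 <= t by rewrite divr_ge0//; lra.
have tT : t <= T by rewrite ler_pdivrMr//; lra.
have it : t \in `[0, T] by rewrite in_itv/= t0.
have k0t : k (g 0) (g t) = t by rewrite gk// sub0r normrN ger0_norm.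
have ktT : k (g t) (g T) = T - t by rewrite gk// distrC ger0_norm// subr_ge0.
exists t; first by rewrite t0.
have := H w _ _ _ Ow (gO _ i0) (gO _ it) (gO _ iT).
have -> : gp w (g 0) (g t) = gp w (g t) (g T).
  by rewrite /gp k0t ktT /t; field.
rewrite minxx {1}/gp ktT (kC Ow (gO _ it)) => h.
(* Both products equal half of k w (gamma t) plus the product of the ends, so hyperbolicity reads (k
   + gp) / 2 - D <= gp, which gives the constant 2 D. *)
have e1 : (k (g t) w + k (g T) w - (T - t)) / 2 = (k (g t) w + gp w (g 0) (g T)) / 2.
  by rewrite /gp k0T /t; field.
by rewrite e1 in h; lra.
Qed.

(** The points u j tend to xi in the Gromov compactification, so F maps them to a sequence with
    limits F xi and p; the two are separated by hand in the one-point compactification. *)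
Lemma cvg_extension_eq (F : gromov_compactification dk -> opc) xi u p :
  continuous F -> (forall x : Omega, F (GInterior _ x) = Some (val x)) ->
  sval xi u ->
  (forall e, 0 < e -> exists N, forall j, (N <= j)%N -> eucl_dist p (val (u j)) < e) ->
  F (GBoundary xi) = Some p.
Proof.
move=> Fc FI xiu up.
have key B : nbhs (F (GBoundary xi)) B -> exists N, forall j, (N <= j)%N -> B (Some (val (u j))).
  move=> /Fc nB; have [N NP] := cvg_gromov_boundary xiu nB.
  by exists N => j /NP; rewrite /= FI.
case: (F (GBoundary xi)) key => [q|] key.
  congr Some; apply: eucl_dist_le0; apply/ler_addgt0Pr => e e0; rewrite add0r.
  have e20 : 0 < e / 2 by rewrite divr_gt0.
  have [|N NP] := key (Some @` [set z | eucl_dist q z < e / 2]).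
    by apply: one_point_compactification_some_nbhs; apply/nbhs_eucl; exists (e / 2).
  have [N' N'P] := up _ e20; pose j := maxn N N'.
  have [z qz [zE]] := NP j (leq_maxl _ _); have := N'P j (leq_maxr _ _).
  rewrite -[val (u j)]/(sval (u j)) -zE => pz; have := eucl_dist_triangle z q p; move: qz => /=.
  by rewrite (eucl_distC z p); lra.
pose B := [set z : 'rV[R]_n | eucl_dist z p <= 1].
have [|N NP] := key ((Some @` (~` B)) `|` [set None]).
  by exists B => //; split; [exact: compact_eucl_ball|exact: closed_eucl_ball].
have [N' N'P] := up _ ltr01; pose j := maxn N N'.
have [[z nz [zE]]|//] := NP j (leq_maxl _ _).
have := N'P j (leq_maxr _ _).
rewrite -[val (u j)]/(sval (u j)) -zE eucl_distC => /ltW.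
by move: nz => /[apply].
Qed.

Lemma extension_visibility (F : gromov_compactification dk -> opc) :
  continuous F -> (forall x : Omega, F (GInterior _ x) = Some (val x)) ->
  QH_visibility_domain Omega.
Proof.
move=> Fc FI; split => // p q ep eq pq; apply: contrapT => H.
have [_ _ [w Ow]] := Odom.
have r0 : 0 < eucl_dist p q.
  by rewrite lt_neqAle eucl_dist_ge0 andbT; apply/eqP => /esym h; apply/pq/eucl_dist_le0; rewrite h.
pose r := eucl_dist p q / 4.
have r0' : 0 < r by rewrite divr_gt0.
pose ball m (z : 'rV[R]_n) := [set y : 'rV[R]_n | eucl_dist y z <= r / m.+1%:R].
have nball m z : nbhs z (ball m z).
  apply/nbhs_eucl; exists (r / m.+1%:R); first by rewrite divr_gt0.
  by move=> y /ltW; rewrite eucl_distC.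
have ballr m z y : ball m z y -> eucl_dist z y <= r.
  rewrite /ball /= eucl_distC => /le_trans; apply.
  by rewrite ler_pdivrMr// ler_peMr ?ler1n// ltW.
(* Failure of visibility is applied to balls of radius r / (m + 1) about p and q and to the compact
   k-ball of radius m. The choice of r as a quarter of |p - q| keeps the closed balls disjoint. *)
have /choice[g gP] : forall m : nat, exists gT : (R -> 'rV[R]_n) * R,
    [/\ qh_geodesic Omega gT.1 gT.2, ball m p (gT.1 0), ball m q (gT.1 gT.2) &
        forall t, 0 <= t <= gT.2 -> m%:R < k w (gT.1 t)].
  move=> m; apply: contrapT => Hm; apply: H.
  exists (ball m p), (ball m q), [set z | Omega z /\ k w z <= m%:R].
  split; [split => //|split].
  - rewrite -!(closure_id _).1; [|exact: closed_eucl_ball..].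
    apply/seteqP; split => // y [/ballr py /ballr qy].
    have := eucl_dist_triangle y p q; rewrite (eucl_distC y); rewrite /r in py qy; lra.
  - exact: compact_qh_ball.
  - by move=> z [].
  - move=> g T gg gp0 gqT; apply: contrapT => Hg; apply: Hm; exists (g, T); split => //= t tT.
    rewrite ltNge; apply/negP => kt; apply: Hg; exists (g t).
    have iT : t \in `[0, T] by rewrite in_itv.
    by split; [exists t|split => //; case: gg => _ gO _; exact: gO].
have gO m t : 0 <= t <= (g m).2 -> Omega ((g m).1 t).
  by move=> tT; have [[_ gO _] _ _ _] := gP m; apply: gO; rewrite in_itv.
have g0 m : 0 <= (g m).2 by have [[]] := gP m.
have b0 m : (0 : R) <= 0 <= (g m).2 by rewrite lexx g0.
have bT m : 0 <= (g m).2 <= (g m).2 by rewrite lexx g0.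
pose x m : Omega := in_domain (gO m 0 (b0 m)); pose y m : Omega := in_domain (gO m _ (bT m)).
pose w' := in_domain Ow.
have ball_cvg z (a : nat -> Omega) : (forall m, ball m z (val (a m))) ->
    forall e, 0 < e -> exists N, forall j, (N <= j)%N -> eucl_dist z (val (a j)) < e.
  move=> az e e0; exists (Num.truncn (r / e)) => j Nj; rewrite eucl_distC.
  apply: le_lt_trans (az j) _; rewrite ltr_pdivrMr// mulrC -ltr_pdivrMr//.
  exact: truncn_lt_nat.
have xp : forall e, 0 < e -> exists N, forall j, (N <= j)%N -> eucl_dist p (val (x j)) < e.
  by apply: ball_cvg => m; case: (gP m).
have yq : forall e, 0 < e -> exists N, forall j, (N <= j)%N -> eucl_dist q (val (y j)) < e.
  by apply: ball_cvg => m; case: (gP m).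
have nat_large M : exists N, forall i, (N <= i)%N -> M <= i%:R :> R.
  by exists (Num.truncn M).+1 => i Ni; exact: ltW (truncn_lt_nat Ni).
have xinf M : exists N, forall i, (N <= i)%N -> M <= k (val w') (val (x i)).
  have [N NP] := nat_large M; exists N => i /NP/le_trans; apply.
  by have [_ _ _ /(_ 0 (b0 i))/ltW] := gP i.
have [D1 D10 HD1] := geodesic_near_product.
have xyinf M : exists N, forall i, (N <= i)%N -> M <= gp w (val (x i)) (val (y i)).
  have [N NP] := nat_large (M + D1); exists N => i /NP Ni.
  have [gg _ _ gk] := gP i; have [t /gk tT] := HD1 _ _ _ Ow gg.
  rewrite -[val (x i)]/((g i).1 0) -[val (y i)]/((g i).1 (g i).2) => h.
  by rewrite -(lerD2r D1) (le_trans Ni)// (le_trans (ltW tT)).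
have [phi phij [xi xiu]] := escape_gromov_boundary Odom OT xinf.
have [u0 [_ gu0 xiP]] := gromov_boundary_rep xi.
have [gx u0x] := xiP _ xiu.
have [D [D0 HD]] := hyp_product.
(* The products of x and y are known for equal indices only; different indices are linked through x
   (phi j) by hyperbolicity. *)
have cross M : exists N, forall i j, (N <= i)%N -> (N <= j)%N ->
    M <= gp w (val (x (phi i))) (val (y (phi j))).
  have /gromov_equivP/(_ w' (M + D))[N NP] := gx; have [N' N'P] := xyinf (M + D).
  exists (maxn N N') => i j; rewrite !geq_max => /andP[Ni N'i] /andP[Nj N'j].
  have := HD w _ _ _ Ow (vO (x (phi i))) (vO (x (phi j))) (vO (y (phi j))).
  apply: le_trans; rewrite lerBrDr le_min; apply/andP; split; first exact: NP.
  exact: N'P (leq_trans N'j (phij _)).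
have u0y : gromov_equiv dk u0 (y \o phi).
  apply: (gromov_equiv_base Odom OT (w0 := w')) => M.
  have [N NP] := cross (M + D); have /gromov_equivP/(_ w' (M + D))[N' N'P] := u0x.
  exists (maxn N N') => i j; rewrite !geq_max => /andP[Ni N'i] /andP[Nj N'j].
  have := HD w _ _ _ Ow (vO (u0 i)) (vO (x (phi j))) (vO (y (phi j))).
  by apply: le_trans; rewrite lerBrDr le_min N'P//= NP.
have gy : gromov_sequence dk (y \o phi).
  apply: (gromov_equiv_base Odom OT (w0 := w')) => M.
  have [N NP] := cross (M + D).
  exists N => i j Ni Nj.
  have := HD w _ _ _ Ow (vO (y (phi i))) (vO (x (phi i))) (vO (y (phi j))).
  by apply: le_trans; rewrite lerBrDr le_min (qh_productC Odom OT)// !NP.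
have xiy : sval xi (y \o phi).
  case: xi xiu xiP => C [u1 gu1 CE] /=; rewrite CE => -[_ u1x] _ /=; split => //.
  apply: (gromov_equiv_base Odom OT (w0 := w')) => M.
  have [N NP] := cross (M + D); have /gromov_equivP/(_ w' (M + D))[N' N'P] := u1x.
  exists (maxn N N') => i j; rewrite !geq_max => /andP[Ni N'i] /andP[Nj N'j].
  have := HD w _ _ _ Ow (vO (u1 i)) (vO (x (phi j))) (vO (y (phi j))).
  by apply: le_trans; rewrite lerBrDr le_min N'P//= NP.
have sub_cvg z (a : nat -> Omega) :
    (forall e, 0 < e -> exists N, forall j, (N <= j)%N -> eucl_dist z (val (a j)) < e) ->
    forall e, 0 < e -> exists N, forall j, (N <= j)%N -> eucl_dist z (val ((a \o phi) j)) < e.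
  move=> az e e0; have [N NP] := az e e0; exists N => j Nj; apply: NP.
  exact: leq_trans (phij _).
have := cvg_extension_eq Fc FI xiu (sub_cvg _ _ xp).
by rewrite (cvg_extension_eq Fc FI xiy (sub_cvg _ _ yq)) => -[/esym].
Qed.

End ExtensionVisibility.

(** * Uniform domains *)

(** Beyond the intermediate value theorem it gives f <= c up to the hitting time. On a reversed
    geodesic it produces a last time. *)
Lemma first_hit {R : realType} (f : R -> R) (T c : R) : 0 <= T ->
  {within `[0, T], continuous f} -> f 0 < c -> c <= f T ->
  exists t, [/\ 0 <= t <= T, f t = c & forall s, 0 <= s <= t -> f s <= c].
Proof.
move=> T0 /within_continuous_real fc f0 fT.
pose S := [set s | 0 <= s <= T /\ c <= f s].
have hS : has_inf S.
  split; first by exists T; rewrite /S /= T0 lexx.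
  by exists 0 => s [/andP[]].
have t0 : 0 <= inf S by apply: lb_le_inf; [case: hS|move=> s [/andP[]]].
have tT : inf S <= T by apply: ge_inf; [case: hS|rewrite /S /= T0 lexx].
have lt_t s : 0 <= s -> s < inf S -> f s < c.
  move=> s0 st; rewrite ltNge; apply/negP => cs; have := st; rewrite ltNge => /negP; apply.
  apply: ge_inf; first by case: hS.
  by split => //; rewrite s0 (le_trans (ltW st)).
have tin : 0 <= inf S <= T by rewrite t0.
have cft : c <= f (inf S).
  apply/ler_addgt0Pr => e e0; have [d d0 dP] := fc _ tin e e0.
  have [s [sT cs] sd] := inf_adherent d0 hS.
  have ts : inf S <= s by apply: ge_inf; [case: hS|].
  have := dP s sT; rewrite ger0_norm ?subr_ge0// ltrBlDl => /(_ sd).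
  by rewrite ltr_distl => /andP[+ _]; lra.
have ftc : f (inf S) <= c.
  apply/ler_addgt0Pr => e e0; have [d d0 dP] := fc _ tin e e0.
  have t0' : 0 < inf S.
    by rewrite lt_neqAle t0 andbT; apply/eqP => h; move: cft; rewrite -h leNgt f0.
  pose s := Num.max 0 (inf S - d / 2).
  have st : s < inf S by rewrite gt_max t0'/=; lra.
  have s0 : 0 <= s by rewrite le_max lexx.
  have sd : inf S - d / 2 <= s by rewrite le_max lexx orbT.
  have := dP s; rewrite s0 (le_trans (ltW st) tT) ltr0_norm ?subr_lt0// opprB.
  move=> /(_ isT)h; have /h : inf S - s < d by lra.
  by rewrite ltr_distl => /andP[_]; have := lt_t s s0 st; lra.
have fc' : f (inf S) = c by apply/eqP; rewrite eq_le ftc.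
exists (inf S); split => // s /andP[s0]; rewrite le_eqVlt => /predU1P[->|/lt_t].
  by rewrite fc'.
by move=> /(_ s0)/ltW.
Qed.

Section UniformDomain.
Context {R : realType} {n : nat} (Omega : set 'rV[R]_n).
Hypothesis OT : Omega <> setT.
Hypothesis Ounif : uniform_domain Omega.
Local Notation delta := (delta Omega).
Local Notation k := (qh_dist Omega).
Local Notation rho := (qh_density Omega).
Implicit Types (x y z p q : 'rV[R]_n) (gamma : R -> 'rV[R]_n) (a b s t e r T M N : R).

Let Odom : domain Omega. Proof. by case: Ounif. Qed.
Let kC := qh_distC Odom OT.
Let kT := qh_dist_triangle Odom OT.

Section arc.
Variables (gamma : R -> 'rV[R]_n) (a b : R).
Hypothesis rg : rectifiable_curve_in Omega gamma a b.
Local Notation len := (curve_length gamma).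

Let ab : a <= b. Proof. by case: rg. Qed.
Let gO t : a <= t <= b -> Omega (gamma t).
Proof. by move=> tab; case: rg => _ _ h _; apply: h; rewrite in_itv. Qed.

Let curve_near t e : a <= t <= b -> 0 < e -> exists2 d : R, 0 < d &
  forall u, a <= u <= b -> `|u - t| < d -> k (gamma t) (gamma u) < e.
Proof.
move=> tab e0; have [d d0 dP] := qh_dist_near Odom OT (gO tab) e0.
have [_ /within_continuous_eucl/(_ t tab d d0)[d' d'0 d'P] _ _] := rg.
by exists d' => // u uab /(d'P u uab)/dP[].
Qed.

Let rect_sub s t : a <= s -> s <= t -> t <= b -> rectifiable_curve_in Omega gamma s t.
Proof.
move=> as_ st tb; have [_ gc _ gfin] := rg; split => //.
- apply: continuous_subspaceW gc => u; rewrite /= !in_itv/= => /andP[su ut].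
  by rewrite (le_trans as_)//= (le_trans ut).
- by move=> u; rewrite in_itv/= => /andP[su ut]; apply: gO; rewrite (le_trans as_)//= (le_trans ut).
- have := rectifiable_sub_fin gfin as_ st tb; rewrite ge0_fin_numE//.
  exact: curve_length_ge0.
Qed.

Let density_bound s t M : a <= s -> s <= t -> t <= b -> 0 <= M ->
  (forall u, s <= u <= t -> rho (gamma u) <= M) ->
  k (gamma s) (gamma t) <= M * fine (len s t).
Proof.
by move=> as_ st tb M0 H; apply: qh_dist_le_bounded_density => //; exact: rect_sub.
Qed.

Variables (c N C : R).
Hypotheses (c0 : 0 < c) (N0 : 0 < N) (C1 : 1 <= C).
Hypothesis ca : c <= delta (gamma a).
Hypothesis cb : c <= delta (gamma b).
Hypothesis cigar : forall t, t \in `[a, b] ->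
  (Order.min (len a t) (len t b) <= (C * delta (gamma t))%:E)%E.
Local Notation L := (fine (len a b)).

Let V t := fine (len a t).
Let W t := fine (len t b).

Let VW t : a <= t <= b -> V t + W t = L.
Proof.
move=> /andP[at_ tb]; have [_ _ _ gfin] := rg.
rewrite /V /W -fineD.
- by rewrite -curve_lengthD.
- exact: (rectifiable_sub_fin gfin (lexx a) at_ tb).
- exact: (rectifiable_sub_fin gfin at_ tb (lexx b)).
Qed.

Let Va : V a = 0. Proof. by rewrite /V curve_lengthxx. Qed.
Let Wb : W b = 0. Proof. by rewrite /W curve_lengthxx. Qed.

Let sub_len s t : a <= s -> s <= t -> t <= b -> fine (len s t) = V t - V s.
Proof. by move=> as_ st tb; have [_ gc _ gfin] := rg; rewrite -(fine_curve_lengthB gfin). Qed.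

Let V_homo s t : a <= s -> s <= t -> t <= b -> V s <= V t.
Proof. by have [_ gc _ gfin] := rg; exact: fine_curve_length_homo. Qed.

Let VWC t : a <= t <= b -> V t <= C * delta (gamma t) \/ W t <= C * delta (gamma t).
Proof.
move=> tab; have /andP[at_ tb] := tab; have [_ _ _ gfin] := rg.
have := @cigar t; rewrite in_itv/= tab => /(_ isT); rewrite ge_min => /orP[h|h]; [left|right].
  by rewrite -lee_fin fineK//; exact: (rectifiable_sub_fin gfin (lexx a) at_ tb).
by rewrite -lee_fin fineK//; exact: (rectifiable_sub_fin gfin at_ tb (lexx b)).
Qed.

(** The cigar condition puts one end of the arc within C delta (gamma t) of gamma t. There delta is
    at least c, and delta is 1-Lipschitz. *)
Let delta_end t : a <= t <= b -> c <= (C + 1) * delta (gamma t).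
Proof.
move=> tab; have /andP[at_ tb] := tab; have [_ gc _ gfin] := rg.
have h1 := delta_lip Odom OT (gamma a) (gamma t).
have h2 := delta_lip Odom OT (gamma b) (gamma t).
have h3 := eucl_dist_le_lengthB gfin (lexx a) at_ tb.
have h4 := eucl_dist_le_lengthB gfin at_ tb (lexx b).
rewrite -/(V a) -/(V t) -/(V b) Va subr0 in h3 h4.
have h5 := VW tab; have h6 := VW (introT andP (conj ab (lexx b))).
rewrite Wb addr0 in h6; rewrite (eucl_distC (gamma b)) in h2.
rewrite mulrDl mul1r addrC; case: (VWC tab) => h.
  by apply: le_trans ca _; apply: le_trans h1 _; rewrite lerD2l (le_trans h3).
apply: le_trans cb _; apply: le_trans h2 _; rewrite lerD2l (le_trans h4)//.
by rewrite h6 -h5 addrAC subrr add0r.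
Qed.

Let rho_end t : a <= t <= b -> rho (gamma t) <= (C + 1) / c.
Proof.
move=> tab; have d0 := delta_gt0 Odom OT (gO tab).
by rewrite ler_pdivlMr// mulrC ler_pdivrMr// delta_end.
Qed.

Let rho_mid t : a <= t <= b -> N * c <= V t -> N * c <= W t ->
  rho (gamma t) <= C / (N * c).
Proof.
move=> tab h1 h2; have d0 := delta_gt0 Odom OT (gO tab).
rewrite ler_pdivlMr ?mulr_gt0// mulrC ler_pdivrMr//.
by case: (VWC tab); apply: le_trans.
Qed.

Let K1 := (C + 1) * N.

Let Cc0 : 0 <= (C + 1) / c.
Proof. by rewrite divr_ge0// ?(ltW c0)//; have := C1; lra. Qed.

Let end_bound_l t : a <= t <= b -> V t <= N * c -> k (gamma a) (gamma t) <= K1.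
Proof.
move=> /andP[at_ tb] Vt.
apply: le_trans (density_bound (lexx a) at_ tb Cc0 _) _.
  by move=> u /andP[au ut]; rewrite rho_end// au (le_trans ut).
have -> : K1 = (C + 1) / c * (N * c) by rewrite /K1; field; rewrite gt_eqF.
by rewrite ler_wpM2l.
Qed.

Let end_bound_r t : a <= t <= b -> W t <= N * c -> k (gamma t) (gamma b) <= K1.
Proof.
move=> /andP[at_ tb] Wt.
apply: le_trans (density_bound at_ tb (lexx b) Cc0 _) _.
  by move=> u /andP[tu ub]; rewrite rho_end// ub (le_trans at_).
have -> : K1 = (C + 1) / c * (N * c) by rewrite /K1; field; rewrite gt_eqF.
by rewrite ler_wpM2l.
Qed.

(* The density is at most [(C + 1) / c] everywhere, and at most [C / (N * c)]
   outside the two end pieces of length [N * c]. *)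
Lemma cigar_qh_bound : k (gamma a) (gamma b) <= 2 * K1 + C / (N * c) * L.
Proof.
have CN0 : 0 <= C / (N * c).
  by rewrite divr_ge0// ?mulr_ge0 ?(ltW N0) ?(ltW c0)//; have := C1; lra.
have L0 : 0 <= L by rewrite fine_ge0// curve_length_ge0.
have CNL : 0 <= C / (N * c) * L by rewrite mulr_ge0.
have ain : a <= a <= b by rewrite lexx ab.
have bin : a <= b <= b by rewrite lexx ab.
have Nc0 : 0 < N * c by rewrite mulr_gt0.
pose S1 := [set t | a <= t <= b /\ V t <= N * c].
pose S2 := [set t | a <= t <= b /\ W t <= N * c].
have h1 : has_sup S1.
  by split; [exists a; rewrite /S1 /= lexx ab Va ltW|exists b => t [/andP[]]].
have h2 : has_inf S2.
  by split; [exists b; rewrite /S2 /= lexx ab Wb ltW|exists a => t [/andP[]]].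
set t1 := sup S1; set t2 := inf S2.
have at1 : a <= t1 by apply: ub_le_sup; [case: h1|rewrite /S1 /= lexx ab Va ltW].
have t1b : t1 <= b by apply: ge_sup; [case: h1|move=> t [/andP[]]].
have at2 : a <= t2 by apply: lb_le_inf; [case: h2|move=> t [/andP[]]].
have t2b : t2 <= b by apply: ge_inf; [case: h2|rewrite /S2 /= lexx ab Wb ltW].
have t1in : a <= t1 <= b by rewrite at1.
have t2in : a <= t2 <= b by rewrite at2.
have V1 t : a <= t -> t <= b -> t1 < t -> N * c < V t.
  move=> at_ tb lt; rewrite ltNge; apply/negP => Vt; move: lt; rewrite ltNge => /negP; apply.
  by apply: ub_le_sup; [case: h1|rewrite /S1 /= at_ tb].
have W2 t : a <= t -> t <= b -> t < t2 -> N * c < W t.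
  move=> at_ tb lt; rewrite ltNge; apply/negP => Wt; move: lt; rewrite ltNge => /negP; apply.
  by apply: ge_inf; [case: h2|rewrite /S2 /= at_ tb].
(* Since continuity of V is not at hand, t1 is not known to belong to S1; points of S1 close to t1
   are used instead. *)
have B1 : k (gamma a) (gamma t1) <= K1.
  apply/ler_addgt0Pr => e e0; have [d d0 dP] := curve_near t1in e0.
  have [s [sab Vs] sd] := sup_adherent d0 h1.
  have st : s <= t1 by apply: ub_le_sup; [case: h1|].
  apply: le_trans (kT (gO ain) (gO sab) (gO t1in)) _; apply: lerD; first exact: end_bound_l.
  rewrite (kC (gO sab) (gO t1in)); apply/ltW/dP => //.
  by rewrite distrC ger0_norm ?subr_ge0// ltrBlDr -ltrBlDl.
have B2 : k (gamma t2) (gamma b) <= K1.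
  apply/ler_addgt0Pr => e e0; have [d d0 dP] := curve_near t2in e0.
  have [s [sab Ws] sd] := inf_adherent d0 h2.
  have st : t2 <= s by apply: ge_inf; [case: h2|].
  rewrite addrC; apply: le_trans (kT (gO t2in) (gO sab) (gO bin)) _.
  apply: lerD; last exact: end_bound_r.
  by apply/ltW/dP => //; rewrite ger0_norm ?subr_ge0// ltrBlDl.
(* If t2 <= t1, the two end pieces cover the arc and there is no middle part. *)
have [t12|t21] := ltP t1 t2; last first.
  suff B3 : k (gamma a) (gamma t2) <= K1.
    apply: le_trans (kT (gO ain) (gO t2in) (gO bin)) _.
    by move: (lerD B3 B2); rewrite -mulr2n -mulr_natl; lra.
  move: t21; rewrite le_eqVlt => /predU1P[->//|t21].
  have [s [/andP[as_ sb] Vs] ts] := sup_gt h1.1 t21.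
  by apply: end_bound_l => //; apply: le_trans Vs; exact/V_homo/sb/ltW.
apply/ler_addgt0Pr => e e0; have e20 : 0 < e / 2 by rewrite divr_gt0.
have [d d0 dP] := curve_near t1in e20; have [d' d'0 d'P] := curve_near t2in e20.
(* The bound on the density of the middle part is established strictly between t1 and t2, so the arc
   is cut at u and v slightly inside, at a total cost of e. *)
pose m := (t1 + t2) / 2.
pose u := Num.min (t1 + d / 2) m; pose v := Num.max (t2 - d' / 2) m.
have um : u <= m by rewrite ge_min lexx orbT.
have mv : m <= v by rewrite le_max lexx orbT.
have t1u : t1 < u by rewrite lt_min; apply/andP; split; rewrite /m; lra.
have vt2 : v < t2 by rewrite gt_max; apply/andP; split; rewrite /m; lra.
have uin : a <= u <= b by apply/andP; split; lra.
have vin : a <= v <= b by apply/andP; split; lra.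
have ud : k (gamma t1) (gamma u) < e / 2.
  apply: dP => //; rewrite gtr0_norm ?subr_gt0// ltrBlDl.
  by rewrite gt_min; apply/orP; left; lra.
have vd : k (gamma v) (gamma t2) < e / 2.
  rewrite (kC (gO vin) (gO t2in)); apply: d'P => //.
  rewrite ltr0_norm ?subr_lt0// opprB ltrBlDr -ltrBlDl.
  by rewrite lt_max; apply/orP; left; lra.
have uv : k (gamma u) (gamma v) <= C / (N * c) * L.
  have [/andP[au ub] /andP[av vb]] := (uin, vin).
  apply: le_trans (density_bound au (le_trans um mv) vb CN0 _) _.
    move=> w /andP[uw wv]; have aw := le_trans au uw; have wb := le_trans wv vb.
    by apply: rho_mid; [rewrite aw|rewrite ltW// V1//; lra|rewrite ltW// W2//; lra].
  apply: ler_wpM2l => //; rewrite sub_len// ?(le_trans um)//.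
  rewrite -(VW bin) Wb addr0; have := V_homo av vb (lexx b).
  by have := V_homo (lexx a) au ub; rewrite Va; lra.
apply: le_trans (kT (gO ain) (gO t1in) (gO bin)) _.
apply: le_trans (lerD B1 (kT (gO t1in) (gO uin) (gO bin))) _.
apply: le_trans (lerD (lexx _) (lerD (ltW ud) (kT (gO uin) (gO vin) (gO bin)))) _.
apply: le_trans (lerD (lexx _) (lerD (lexx _) (lerD uv (kT (gO vin) (gO t2in) (gO bin))))) _.
move: (k (gamma v) (gamma t2)) (k (gamma t2) (gamma b)) vd B2 => z1 z2 vd B2; lra.
Qed.

End arc.

Lemma uniform_qh_bound : exists2 A, 0 <= A & forall x y c, Omega x -> Omega y ->
  0 < c -> c <= delta x -> c <= delta y -> k x y <= A + eucl_dist x y / (4 * c).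
Proof.
(* With this N, and arc length at most C |x - y|, the middle term C / (N c) times the length is at
   most |x - y| / (4 c). *)
have [_ [C C1 H]] := Ounif; pose N := 4 * C ^+ 2.
have C0 : 0 < C by lra.
have N0 : 0 < N by rewrite mulr_gt0// exprn_gt0.
exists (2 * ((C + 1) * N)); first by rewrite mulr_ge0// mulr_ge0// ?(ltW N0)//; lra.
move=> x y c Ox Oy c0 cx cy.
have [g [a [b [[rg _ ga gb] [gl gc]]]]] := H x y Ox Oy.
rewrite -ga in cx; rewrite -gb in cy.
have := cigar_qh_bound rg c0 N0 C1 cx cy gc; rewrite ga gb => /le_trans; apply.
rewrite lerD2l; have [ab _ _ gfin] := rg.
have : fine (curve_length g a b) <= C * eucl_dist x y.
  rewrite -lee_fin fineK//; exact: (rectifiable_sub_fin gfin (lexx a) ab (lexx b)).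
have CNc : 0 <= C / (N * c) by rewrite divr_ge0 ?mulr_ge0// ltW.
move/(ler_wpM2l CNc)/le_trans; apply.
rewrite le_eqVlt; apply/orP; left; apply/eqP; rewrite /N; field.
by rewrite !gt_eqF.
Qed.

Section geodesic.

(** Infinitesimally |dz| = delta dk. Locally, [qh_dist_ge_eucl] gives |gamma v - gamma z| <= |v - z|
    (f + e), and [subadditive_local_le0] globalizes this, so the geodesic need not be known to be
    rectifiable. *)
Lemma geodesic_eucl_le gamma T s t f : qh_geodesic Omega gamma T ->
  0 <= s -> s <= t -> t <= T -> (forall u, s <= u <= t -> delta (gamma u) <= f) ->
  eucl_dist (gamma s) (gamma t) <= f * (t - s).
Proof.
move=> gg s0 st tT H; have [T0 gO gk] := gg.
have /within_continuous_eucl gc := geodesic_continuous Odom OT gg.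
rewrite -subr_le0; pose Phi s t := eucl_dist (gamma s) (gamma t) - f * (t - s).
apply: (@subadditive_local_le0 _ s t Phi) => //.
  move=> u v w _ _ _ _; rewrite /Phi; have := eucl_dist_triangle (gamma v) (gamma u) (gamma w); lra.
move=> e e0 v /andP[sv vt].
have vT : 0 <= v <= T by apply/andP; split; lra.
have [d d0 dP] := gc v vT e e0; exists d => // u w su uv vw wt du dw.
have step (z : R) : s <= z <= t -> `|z - v| < d ->
    eucl_dist (gamma v) (gamma z) <= `|z - v| * (f + e).
  move=> /andP[sz zt] zv; have zT : 0 <= z <= T by apply/andP; split; lra.
  have Ov : Omega (gamma v) by apply: gO; rewrite in_itv.
  have Oz : Omega (gamma z) by apply: gO; rewrite in_itv.
  apply: le_trans (qh_dist_ge_eucl Odom OT Ov Oz) _.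
  rewrite gk ?in_itv//= distrC ler_wpM2l// lerD//.
    by apply: H; rewrite sv.
  exact/ltW/dP.
have h1 := step u; have h2 := step w.
rewrite distrC ger0_norm ?subr_ge0// in h1; rewrite ger0_norm ?subr_ge0// in h2.
have {}h1 : eucl_dist (gamma v) (gamma u) <= (v - u) * (f + e).
  by apply: h1; [apply/andP; split|]; lra.
have {}h2 : eucl_dist (gamma v) (gamma w) <= (w - v) * (f + e).
  by apply: h2; [apply/andP; split|]; lra.
have := eucl_dist_triangle (gamma v) (gamma u) (gamma w).
rewrite (eucl_distC (gamma u) (gamma v)) /Phi; lra.
Qed.

Variable A : R.
Hypothesis A0 : 0 <= A.
Hypothesis kA : forall x y c, Omega x -> Omega y ->
  0 < c -> c <= delta x -> c <= delta y -> k x y <= A + eucl_dist x y / (4 * c).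

(** With D the distance of the ends and c = f/2 in the hypothesis on k: D <= f (t - s) <= f (A + D /
    (2 f)) = f A + D / 2. *)
Let geodesic_step gamma T s t f : qh_geodesic Omega gamma T ->
  0 <= s -> s <= t -> t <= T -> 0 < f -> (forall u, s <= u <= t -> delta (gamma u) <= f) ->
  f / 2 <= delta (gamma s) -> f / 2 <= delta (gamma t) ->
  eucl_dist (gamma s) (gamma t) <= 2 * A * f.
Proof.
move=> gg s0 st tT f0 H fs ft; have [T0 gO gk] := gg.
have sin : s \in `[0, T] by rewrite in_itv/= s0 (le_trans st).
have tin : t \in `[0, T] by rewrite in_itv/= tT (le_trans s0).
have h1 := geodesic_eucl_le gg s0 st tT H.
have f20 : 0 < f / 2 by rewrite divr_gt0.
have := kA (gO _ sin) (gO _ tin) f20 fs ft.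
rewrite gk// distrC ger0_norm ?subr_ge0//.
move: (eucl_dist _ _) h1 => D h1 h2.
have : f * (t - s) <= f * (A + D / (4 * (f / 2))) by rewrite ler_wpM2l// ltW.
have -> : f * (A + D / (4 * (f / 2))) = f * A + D / 2 by field; rewrite gt_eqF.
lra.
Qed.

(* The piece before the last time delta takes the value f/2 has Euclidean size
   at most 2 A f; the induction hypothesis bounds the rest. *)
Lemma geodesic_halving (N : nat) gamma T f : qh_geodesic Omega gamma T -> 0 < f ->
  delta (gamma 0) = f -> (forall s, 0 <= s <= T -> delta (gamma s) <= f) ->
  f <= 2 ^+ N * delta (gamma T) ->
  eucl_dist (gamma 0) (gamma T) <= 4 * A * f.
Proof.
elim: N gamma T f => [|N IH] gamma T f gg f0 d0 df fN; have [T0 gO gk] := gg.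
  have h : eucl_dist (gamma 0) (gamma T) <= 2 * A * f.
    apply: (geodesic_step gg (lexx 0) T0 (lexx T) f0 df); first by rewrite d0; lra.
    by move: fN; rewrite expr0 mul1r; lra.
  by apply: le_trans h _; rewrite ler_pM2r// ler_wpM2r// ler_nat.
have [fT|Tf] := leP (f / 2) (delta (gamma T)).
  have h : eucl_dist (gamma 0) (gamma T) <= 2 * A * f.
    by apply: (geodesic_step gg (lexx 0) T0 (lexx T) f0 df) => //; rewrite d0; lra.
  by apply: le_trans h _; rewrite ler_pM2r// ler_wpM2r// ler_nat.
(* The first hit of f/2 on the reversed geodesic is the last one on gamma; after it delta <= f/2, as
   the induction hypothesis demands. *)
have gg' := geodesic_rev gg.
have gc : {within `[0, T], continuous (fun s => delta (gamma (T - s)))}.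
  have /subspace_continuousP gc := geodesic_continuous Odom OT gg'.
  apply/subspace_continuousP => s sT; apply: cvg_comp; first exact: gc.
  exact: continuous_delta.
have [||u [/andP[u0 uT] uf uh]] := first_hit T0 gc (c := f / 2).
- by rewrite subr0.
- by rewrite subrr d0; lra.
have Tu0 : 0 <= T - u by rewrite subr_ge0.
have TuT : T - u <= T by rewrite lerBlDr lerDl.
have f20 : 0 < f / 2 by rewrite divr_gt0.
have h1 : eucl_dist (gamma 0) (gamma (T - u)) <= 2 * A * f.
  apply: (geodesic_step gg (lexx 0) Tu0 TuT f0) => //.
  - by move=> s /andP[s0 su]; apply: df; rewrite s0 (le_trans su).
  - by rewrite d0; lra.
  - by rewrite uf.
have gs := geodesic_sub gg Tu0 TuT (lexx T); rewrite subKr in gs.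
have h2 := IH _ _ (f / 2) gs f20.
rewrite addr0 uf subrK in h2.
have {}h2 : eucl_dist (gamma (T - u)) (gamma T) <= 4 * A * (f / 2).
  apply: h2 => //.
    move=> s /andP[s0 su]; have -> : T - u + s = T - (u - s) by ring.
    by apply: uh; apply/andP; split; lra.
  by move: fN; rewrite exprS -mulrA; lra.
(* 2 A f + 4 A (f / 2) = 4 A f, so the bound does not grow with N. *)
have := eucl_dist_triangle (gamma (T - u)) (gamma 0) (gamma T); lra.
Qed.

(** The geodesic is cut where delta is largest, and [geodesic_halving] is applied from there in both
    directions; hence 8 = 4 + 4. *)
Lemma geodesic_diameter gamma T m : qh_geodesic Omega gamma T ->
  (forall s, 0 <= s <= T -> delta (gamma s) <= m) ->
  eucl_dist (gamma 0) (gamma T) <= 8 * A * m.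
Proof.
move=> gg dm; have [T0 gO gk] := gg.
have gc : {within `[0, T], continuous (fun s => delta (gamma s))}.
  have /subspace_continuousP gc := geodesic_continuous Odom OT gg.
  apply/subspace_continuousP => s sT; apply: cvg_comp; first exact: gc.
  exact: continuous_delta.
have [t tT tmax] := EVT_max T0 gc.
move: tT; rewrite in_itv/= => tT; have /andP[t0 tT'] := tT.
have half g S : qh_geodesic Omega g S -> delta (g 0) = delta (gamma t) ->
    (forall s, 0 <= s <= S -> delta (g s) <= delta (gamma t)) ->
    eucl_dist (g 0) (g S) <= 4 * A * delta (gamma t).
  move=> [S0 gSO gSk] gd gh; have f0 : 0 < delta (gamma t).
    by apply: (delta_gt0 Odom OT); apply: gO; rewrite in_itv.
  have dS : 0 < delta (g S).
    by apply: (delta_gt0 Odom OT); apply: gSO; rewrite in_itv/= S0 lexx.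
  (* The number of halvings depends on how close the end is to the boundary; any N with 2 ^ N at
     least the ratio will do. *)
  apply: (geodesic_halving (N := Num.truncn (delta (gamma t) / delta (g S)))) => //.
  rewrite -ler_pdivrMr//; apply: le_trans (ltW (Num.Theory.truncnS_gt _)) _.
  by rewrite -natrX ler_nat ltn_expl.
have gs1 := geodesic_sub gg t0 tT' (lexx T).
have gs2 := geodesic_rev (geodesic_sub gg (lexx 0) t0 tT'); rewrite subr0 in gs2.
have h1 := half _ _ gs1; rewrite addr0 subrKC in h1.
have h2 := half _ _ gs2; rewrite subr0 add0r subrr addr0 in h2.
have {}h1 : eucl_dist (gamma t) (gamma T) <= 4 * A * delta (gamma t).
  apply: h1 => // s /andP[s0 sT]; apply: tmax; rewrite in_itv/=.
  by apply/andP; split; lra.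
have {}h2 : eucl_dist (gamma t) (gamma 0) <= 4 * A * delta (gamma t).
  apply: h2 => // s /andP[s0 sT]; apply: tmax; rewrite in_itv/=.
  by apply/andP; split; lra.
have h3 : 8 * A * delta (gamma t) <= 8 * A * m by rewrite ler_wpM2l ?mulr_ge0// dm.
have := eucl_dist_triangle (gamma t) (gamma 0) (gamma T).
by rewrite (eucl_distC (gamma 0) (gamma t)); lra.
Qed.

End geodesic.

Lemma uniform_visibility : QH_visibility_domain Omega.
Proof.
split => // p q ep eq pq; have [A A0 kA] := uniform_qh_bound.
have r0 : 0 < eucl_dist p q.
  by rewrite lt_neqAle eucl_dist_ge0 andbT; apply/eqP => /esym h; apply/pq/eucl_dist_le0; rewrite h.
pose r := eucl_dist p q / 4.
have r0' : 0 < r by rewrite divr_gt0.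
pose ball (z : 'rV[R]_n) := [set y : 'rV[R]_n | eucl_dist y z <= r].
have nball z : nbhs z (ball z).
  by apply/nbhs_eucl; exists r => // y /ltW; rewrite eucl_distC.
(* Chosen so that 8 A eps < r: a geodesic with delta <= eps that starts within r of p cannot reach
   distance 2 r from p. *)
pose eps := r / (8 * A + 1).
have A80 : 0 < 8 * A + 1 by rewrite ltr_wpDl// mulr_ge0.
have eps0 : 0 < eps by rewrite divr_gt0.
pose K := [set z | Omega z /\ eps <= delta z] `&` [set z | eucl_dist z p <= 2 * r].
exists (ball p), (ball q), K; split; split => //.
- rewrite -!(closure_id _).1; [|exact: closed_eucl_ball..].
  apply/seteqP; split => // y [/= py qy]; exfalso; have := eucl_dist_triangle y p q.
  rewrite (eucl_distC p y) leNgt => /negP; apply; apply: le_lt_trans (lerD py qy) _.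
  by rewrite /r; lra.
- apply: (@compact_eucl_bounded _ _ _ p (2 * r)) => [z cz|z []//].
  split; first by apply: (closure_delta_ge Odom OT eps0 _ cz) => u [].
  have /closure_id -> := @closed_eucl_ball _ _ p (2 * r).
  by apply: closure_subset cz => u [].
- by move=> z [[]].
move=> gamma T gg gp gq; apply: contrapT => HK; have [T0 gO gk] := gg.
have gc := geodesic_eucl_dist_continuous Odom OT (p := p) gg.
(* Up to this time the geodesic stays within 2 r of p, so it can avoid K only by keeping delta below
   eps. *)
have [||t [/andP[t0 tT] tr th]] := first_hit T0 gc (c := 2 * r).
- by apply: le_lt_trans gp _; rewrite ltr_pMl// ltr1n.
- have := eucl_dist_triangle (gamma T) p q; rewrite (eucl_distC p (gamma T)) => h.
  have := le_trans h (lerD (lexx _) gq); rewrite /r; lra.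
have dm s : 0 <= s <= t -> delta (gamma s) <= eps.
  move=> sT; rewrite leNgt; apply/negP => es; apply: HK; exists (gamma s).
  have sT' : s \in `[0, T] by move: sT; rewrite in_itv/= => /andP[-> st]; rewrite (le_trans st).
  by split; [exists s|split; [split; [exact: gO|exact: ltW]|exact: th]].
have gs := geodesic_sub gg (lexx 0) t0 tT; rewrite subr0 in gs.
have := geodesic_diameter A0 kA gs (m := eps); rewrite !add0r => h.
have {}h : eucl_dist (gamma 0) (gamma t) <= 8 * A * eps.
  by apply: h => s; rewrite add0r; exact: dm.
have h3 : 8 * A * eps < r.
  by rewrite /eps mulrA ltr_pdivrMr// mulrC ltr_pM2l// ltrDl.
have := eucl_dist_triangle (gamma 0) (gamma t) p.
rewrite tr (eucl_distC (gamma t)) => h4.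
by have := le_trans h4 (lerD h gp); lra.
Qed.

End UniformDomain.

Theorem theorem2p12 (R : realType) (n : nat) (hn : (2 <= n)%N) :
  (forall Omega : set 'rV[R]_n,
     domain Omega -> Omega <> setT -> gromov_hyperbolic (@qh_metric R n Omega) ->
     (QH_visibility_domain Omega <->
      exists F : gromov_compactification (@qh_metric R n Omega) ->
                 one_point_compactification 'rV[R]_n,
        [/\ continuous F,
            forall x : Omega, F (GInterior _ x) = Some (val x) &
            range F = closure_infty Omega])) /\
  (forall Omega : set 'rV[R]_n,
     uniform_domain Omega -> Omega <> setT -> ~ bounded_set Omega ->
     QH_visibility_domain Omega).
Proof.
split=> [D Ddom DT hyp|D Dunif DT _]; last exact: uniform_visibility.
split=> [vis|[ext [extc extI _]]]; last exact: extension_visibility hyp _ extc extI.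
exists (visibility_extension Ddom DT vis); split=> //.
- exact: visibility_extension_continuous.
- exact: visibility_extension_range.
Qed.
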